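(* Suppose that for all sufficiently large $t$ there is a fan-in-2 Boolean circuit of depth $O(\log t)$ that, on input $(x_1,\ldots,x_t)\in(A_t)^t$, decides whether $x_1x_2\cdots x_t=\mathrm{id}$. Then $\mathrm{NC}^1=\mathrm{L}$.
   Context: $A_t$ is the alternating group on $\{1,\ldots,t\}$ with identity $\mathrm{id}$; permutations are encoded in pointwise representation $(\sigma(1),\ldots,\sigma(t))$. No promise is made on the product. $\mathrm{NC}^1$ is the class of polynomial-size, logarithmic-depth, fan-in-2 Boolean circuit families; $\mathrm{L}$ is logarithmic space.
   Formalization: L in the conclusion is read non-uniformly, as L/poly (logarithmic space with polynomial advice), because NC^1 as non-uniform circuit families contains undecidable unary languages and so cannot equal uniform L; uniform L ⊆ NC^1 still follows. *)

(* Defs.v *)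
From mathcomp Require Import all_boot all_fingroup all_solvable.

Set Implicit Arguments.
Unset Strict Implicit.
Unset Printing Implicit Defensive.

(* Fan-in-2 Boolean circuits over input variables indexed by I: a circuit is a
   topologically sorted list of gates, operands being positions of earlier
   gates (so gates may be shared). *)

Variant gate (I : Type) :=
  | GInput of I
  | GConst of bool
  | GNot of nat
  | GAnd of nat & nat
  | GOr of nat & nat.

Arguments GConst {I}.
Arguments GNot {I}.
Arguments GAnd {I}.
Arguments GOr {I}.

Definition operands I (g : gate I) : seq nat :=
  match g with
  | GInput _ | GConst _ => [::]
  | GNot j => [:: j]
  | GAnd j k | GOr j k => [:: j; k]
  end.

Definition well_ordered I (gs : seq (gate I)) : Prop :=
  forall i, i < size gs -> all (gtn i) (operands (nth (GConst false) gs i)).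

Record circuit (I : Type) := Circuit {
  gates : seq (gate I);
  output : nat;
  gates_well_ordered : well_ordered gates;
  output_lt_size : output < size gates
}.

Definition gate_value I (x : I -> bool) (vs : seq bool) (g : gate I) : bool :=
  match g with
  | GInput i => x i
  | GConst b => b
  | GNot j => ~~ nth false vs j
  | GAnd j k => nth false vs j && nth false vs k
  | GOr j k => nth false vs j || nth false vs k
  end.

Definition gate_values I (x : I -> bool) (gs : seq (gate I)) : seq bool :=
  foldl (fun vs g => rcons vs (gate_value x vs g)) [::] gs.

Definition circuit_eval I (C : circuit I) (x : I -> bool) : bool :=
  nth false (gate_values x (gates C)) (output C).

Definition gate_depth I (ds : seq nat) (g : gate I) : nat :=
  match g with
  | GInput _ | GConst _ => 0
  | GNot j => (nth 0 ds j).+1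
  | GAnd j k | GOr j k => (maxn (nth 0 ds j) (nth 0 ds k)).+1
  end.

Definition gate_depths I (gs : seq (gate I)) : seq nat :=
  foldl (fun ds g => rcons ds (gate_depth ds g)) [::] gs.

Definition circuit_depth I (C : circuit I) : nat :=
  nth 0 (gate_depths (gates C)) (output C).

Definition circuit_size I (C : circuit I) : nat := size (gates C).

(* Pointwise binary encoding of a word (x_1, ..., x_t) of permutations of
   {0, ..., t-1}: variable (k, i, b) is bit b of the number x_k(i), which is
   written with ceil(log2 t) bits. *)

Definition word_index (t : nat) : Type := 'I_t * 'I_t * 'I_(up_log 2 t).

Definition word_bits (t : nat) (x : 'I_t -> {perm 'I_t}) (v : word_index t) :
    bool :=
  let: (k, i, b) := v in odd (x k i %/ 2 ^ b).

(* Nothing is required on assignments that do not encode a word over A_t. *)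
Definition decides_Alt_word_problem (t : nat) (C : circuit (word_index t)) :
    Prop :=
  forall x : 'I_t -> {perm 'I_t},
    (forall k, x k \in ('Alt_('I_t))%g) ->
    circuit_eval C (word_bits x) <-> (\prod_(k < t) x k = 1)%g.

Definition language (S : Type) := seq S -> Prop.

(* Up to constants, n ^ k + k stands for an arbitrary polynomial and
   (trunc_log 2 n).+1 for log n; the successor only matters for n <= 1. *)

Definition NC1 (A : language bool) : Prop :=
  exists c k : nat, forall n : nat, exists C : circuit 'I_n,
    [/\ circuit_size C <= n ^ k + k,
        circuit_depth C <= c * (trunc_log 2 n).+1 &
        forall x : n.-tuple bool, A x <-> circuit_eval C (tnth x)].

(* Deterministic Turing machines with a two-way read-only input tape, delimited
   by end markers, and one work tape, infinite to the right. *)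

Variant insym (S : Type) := LEnd | Sym of S | REnd.

Arguments LEnd {S}.
Arguments REnd {S}.

Variant move := MLeft | MStay | MRight.

Record machine (S : Type) := Machine {
  state : finType;
  walpha : finType;
  blank : walpha;
  q_init : state;
  q_acc : state;
  q_rej : state;
  q_acc_neq_rej : q_acc != q_rej;
  trans : state -> insym S -> walpha -> state * walpha * move * move
}.

Record config S (M : machine S) := Config {
  cstate : state M;
  cinhead : nat;
  cwtape : nat -> walpha M;
  cwhead : nat
}.

Definition move_head (m : move) (p : nat) : nat :=
  match m with MLeft => p.-1 | MStay => p | MRight => p.+1 end.

(* Position 0 holds LEnd, positions 1, ..., |x| the input, |x| + 1 REnd. *)
Definition read_input S (x : seq S) (p : nat) : insym S :=
  nth REnd (LEnd :: [seq Sym a | a <- x]) p.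

Definition halted S (M : machine S) (c : config M) : bool :=
  (cstate c == q_acc M) || (cstate c == q_rej M).

Definition step S (M : machine S) (x : seq S) (c : config M) : config M :=
  if halted c then c else
  let: (q, a, mi, mw) :=
    trans (cstate c) (read_input x (cinhead c)) (cwtape c (cwhead c)) in
  Config q
    (minn (move_head mi (cinhead c)) (size x).+1)
    (fun p => if p == cwhead c then a else cwtape c p)
    (move_head mw (cwhead c)).

Definition init_config S (M : machine S) : config M :=
  Config (q_init M) 0 (fun=> blank M) 0.

Definition run S (M : machine S) (x : seq S) (T : nat) : config M :=
  iter T (step x) (init_config M).

Definition decides S (M : machine S) (B : language S) : Prop :=
  forall x,
    (exists T, halted (run M x T)) /\
    (B x <-> exists T, cstate (run M x T) = q_acc M).

(* The work head never leaves the first O(log |x|) cells. *)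
Definition logspace_bounded S (M : machine S) : Prop :=
  exists c : nat, forall x T,
    cwhead (run M x T) <= c * (trunc_log 2 (size x)).+1.

Definition logspace (S : finType) (B : language S) : Prop :=
  exists M : machine S, logspace_bounded M /\ decides M B.

(* Non-uniform logarithmic space L/poly: a logarithmic-space language applied
   to the input followed by a separator and an advice string that depends only
   on the length of the input and has polynomial length. *)

Definition with_advice (x a : seq bool) : seq (option bool) :=
  [seq Some b | b <- x] ++ None :: [seq Some b | b <- a].

Definition Lpoly (A : language bool) : Prop :=
  exists (B : language (option bool)) (advice : nat -> seq bool) (k : nat),
    [/\ logspace B,
        forall n, size (advice n) <= n ^ k + k &
        forall x, A x <-> B (with_advice x (advice (size x)))].

(* M, taking the separator for its right end marker. *)
Definition mask_advice (M : machine bool) : machine (option bool) :=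
  @Machine (option bool) (state M) (walpha M) (blank M) (q_init M) (q_acc M)
    (q_rej M) (q_acc_neq_rej M)
    (fun q s w =>
       match s with
       | LEnd => trans q LEnd w
       | Sym (Some b) => trans q (Sym b) w
       | Sym None | REnd =>
           let: (q', a, mi, mw) := trans q REnd w in
           (q', a, if mi is MRight then MStay else mi, mw)
       end).

Definition unmask (M : machine bool) (c : config (mask_advice M)) : config M :=
  @Config _ M (cstate c) (cinhead c) (cwtape c) (cwhead c).

Fixpoint before_sep (y : seq (option bool)) : seq bool :=
  if y is Some b :: y' then b :: before_sep y' else [::].

Lemma size_before_sep y : size (before_sep y) <= size y.
Proof. by elim: y => [|[b|] y IH]. Qed.

Lemma before_sepK x a : before_sep (with_advice x a) = x.
Proof. by rewrite /with_advice; elim: x => //= b x ->. Qed.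

Lemma read_before_sep y p : p <= (size (before_sep y)).+1 ->
  read_input (before_sep y) p =
    (match read_input y p with
     | LEnd => LEnd | Sym (Some b) => Sym b | Sym None | REnd => REnd
     end)
  /\ (p == (size (before_sep y)).+1) =
     (match read_input y p with Sym None | REnd => true | _ => false end).
Proof.
rewrite /read_input; case: p => [|p] //=; rewrite ltnS eqSS.
elim: y p => [|[b|] y IH] [|p] //=; exact: IH.
Qed.

Lemma run_mask (M : machine bool) y T :
  unmask (run (mask_advice M) y T) = run M (before_sep y) T /\
  cinhead (run (mask_advice M) y T) <= (size (before_sep y)).+1.
Proof.
elim: T => [|T [IH le_p]] //; rewrite /run !iterS -!/(run _ _ T) -{}IH.
case: (run (mask_advice M) y T) le_p => q p w h /= le_p.
rewrite /step /halted /=; case: ifP => // _.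
have le_s := size_before_sep y.
have [-> eq_p] := read_before_sep le_p.
have lt_case mi : p != (size (before_sep y)).+1 ->
    minn (move_head mi p) (size y).+1 = move_head mi p /\
    minn (move_head mi p) (size (before_sep y)).+1 = move_head mi p.
  move=> ne_p; have lt_p : p < (size (before_sep y)).+1.
    by rewrite ltn_neqAle ne_p.
  have le_m : move_head mi p <= (size (before_sep y)).+1.
    by case: mi => //=; exact: leq_trans (leq_pred _) _.
  by split; apply/minn_idPl => //; apply: leq_trans le_m _.
have eq_case mi : p == (size (before_sep y)).+1 ->
    minn (move_head (if mi is MRight then MStay else mi) p) (size y).+1 =
    minn (move_head mi p) (size (before_sep y)).+1.
  move/eqP=> ->; case: mi => /=.
  - by rewrite !(minn_idPl (leqW _)).
  - by rewrite minnn; apply/minn_idPl.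
  - rewrite (minn_idPr (leqnSn _)); exact/minn_idPl.
case: (read_input y p) eq_p => [|[b|]|] eq_p.
- case: (@trans _ M q LEnd (w h)) => [[[q' a] mi] mw] /=; have [|e1 e2] := lt_case mi.
    by rewrite eq_p.
  by rewrite /unmask /= e1 e2; split=> //; rewrite -e2 geq_minr.
- case: (@trans _ M q (Sym b) (w h)) => [[[q' a] mi] mw] /=; have [|e1 e2] := lt_case mi.
    by rewrite eq_p.
  by rewrite /unmask /= e1 e2; split=> //; rewrite -e2 geq_minr.
- case: (@trans _ M q REnd (w h)) => [[[q' a] mi] mw] /=.
  by rewrite /unmask /= eq_case // geq_minr.
- case: (@trans _ M q REnd (w h)) => [[[q' a] mi] mw] /=.
  by rewrite /unmask /= eq_case // geq_minr.
Qed.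

Lemma logspace_Lpoly (A : language bool) : logspace A -> Lpoly A.
Proof.
case=> M [[c bndM] decM].
exists (A \o before_sep), (fun=> [::]), 0; split=> //; last first.
  by move=> x; rewrite /= before_sepK.
exists (mask_advice M); split.
  exists c => y T; have [e _] := run_mask M y T.
  rewrite -[cwhead _]/(cwhead (unmask (run (mask_advice M) y T))) e.
  apply: leq_trans (bndM _ _) _.
  by rewrite leq_mul2l ltnS leq_trunc_log ?orbT ?size_before_sep.
move=> y; have [[T hT] accM] := decM (before_sep y); split.
  by exists T; move: hT; rewrite -(proj1 (run_mask M y T)).
apply: (iff_trans accM); split=> -[T' hT']; exists T'.
  by move: hT'; rewrite -(proj1 (run_mask M y T')).
by rewrite -(proj1 (run_mask M y T')).
Qed.

(* Main.v *)
From HB Require Import structures.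
Require Import Defs.
From mathcomp Require Import all_boot all_fingroup all_solvable.
From mathcomp Require Import zify.
From Stdlib Require Import FunctionalExtensionality IndefiniteDescription.

Set Implicit Arguments.
Unset Strict Implicit.
Unset Printing Implicit Defensive.

(** L/poly is contained in NC^1.  Number the pairs (time, configuration) so that
    the successor h(i) of node i satisfies i < h(i); this is a forest whose roots
    are a rejecting sink and an accepting sink.  The product of the transpositions
    (i h(i)), over all i and in any fixed order, has the trees of the forest as its
    cycles.  Hang on the rejecting sink a tail of more than half of the nodes and
    multiply by one more transposition, joining the accepting sink to the start
    node.  If the computation rejects, the result is a single cycle through all N
    nodes and its N-th power is the identity; if it accepts, the cycle of the
    rejecting sink has a length strictly between N / 2 and N and the N-th power is
    not the identity.  Each transposition depends on a single input bit, so every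
    bit of the word given to the circuits for A_t is a literal or a constant.

    NC^1 is contained in L/poly.  By the method of Ben-Or and Cleve a formula of
    depth d becomes a sequence of at most 4^d instructions R_i += R_j x_v over
    three registers in F_2.  The advice spells out this sequence, and it is executed
    by a two-head finite automaton, which a logarithmic space machine simulates
    with one real head and two binary counters. *)

(** * Polynomial bounds, formulas and circuits *)

Definition log_len (n : nat) : nat := (trunc_log 2 n).+1.

(** Bounds are kept as powers of [2 ^ log_len n], so that products add exponents and logarithms
    become linear in [log_len n]; [polynomial_bound] returns to the form [n ^ k + k]. *)
Definition poly_bounded (f : nat -> nat) : Prop :=
  exists k, forall n, f n <= 2 ^ (k * log_len n).

Lemma leq_exp2 m n : m <= n -> 2 ^ m <= 2 ^ n.
Proof. by rewrite leq_exp2l. Qed.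

Lemma poly_bounded_const c : poly_bounded (fun=> c).
Proof.
exists c => n; apply: leq_trans (ltnW (ltn_expl c (leqnn 2))) _.
by rewrite leq_exp2 // leq_pmulr.
Qed.

Lemma poly_bounded_id : poly_bounded id.
Proof. by exists 1 => n; rewrite mul1n; apply/ltnW/trunc_log_ltn. Qed.

Lemma poly_bounded_mul f g :
  poly_bounded f -> poly_bounded g -> poly_bounded (fun n => f n * g n).
Proof.
case=> [k Hf] [l Hg]; exists (k + l) => n.
by rewrite mulnDl expnD leq_mul.
Qed.

Lemma poly_bounded_add f g :
  poly_bounded f -> poly_bounded g -> poly_bounded (fun n => f n + g n).
Proof.
case=> [k Hf] [l Hg]; exists (k + l).+1 => n.
apply: (@leq_trans (2 ^ (1 + (k + l) * log_len n))); last first.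
  by rewrite leq_exp2 // mulSn leq_add2r.
rewrite expnD mulnDl expnD expn1 mul2n -addnn; apply: leq_add.
  by apply: leq_trans (Hf n) _; rewrite leq_pmulr ?expn_gt0.
by apply: leq_trans (Hg n) _; rewrite leq_pmull ?expn_gt0.
Qed.

Lemma poly_bounded_exp f k : poly_bounded f -> poly_bounded (fun n => f n ^ k).
Proof.
move=> Hf; elim: k => [|k IH]; first exact: poly_bounded_const.
by have [l Hl] := poly_bounded_mul Hf IH; exists l => n; rewrite expnS Hl.
Qed.

Lemma log_len_poly f : poly_bounded f ->
  exists k, forall n, log_len (f n) <= k * log_len n.
Proof.
case=> k Hf; exists k.+1 => n.
apply: (@leq_trans (k * log_len n).+1).
  by rewrite ltnS -(trunc_expnK (k * log_len n) (leqnn 2)) leq_trunc_log.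
by rewrite mulSn -add1n leq_add2r.
Qed.

Lemma poly_bounded_exp_log f k : poly_bounded f ->
  poly_bounded (fun n => 2 ^ (k * log_len (f n))).
Proof.
move/log_len_poly=> [l Hl]; exists (k * l) => n.
by rewrite leq_exp2 // -mulnA leq_mul2l Hl orbT.
Qed.

Lemma poly_bounded_leq f g : (forall n, f n <= g n) ->
  poly_bounded g -> poly_bounded f.
Proof. by move=> le_fg [k Hg]; exists k => n; apply: leq_trans (le_fg n) _. Qed.

Lemma poly_bounded_polynomial k : poly_bounded (fun n => n ^ k + k).
Proof.
apply: poly_bounded_add; last exact: poly_bounded_const.
exact: poly_bounded_exp poly_bounded_id.
Qed.

Lemma polynomial_bound f : poly_bounded f -> exists k, forall n, f n <= n ^ k + k.
Proof.
(* The summand [2 ^ k] covers [n <= 1], where [log_len n] is 1. For [n >= 2],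
   [2 ^ log_len n <= n ^ 2], so the exponent [2 * k] is enough. *)
case=> k Hf; exists (2 ^ k + 2 * k) => n; apply: leq_trans (Hf n) _.
have [n1|n2] := leqP n 1.
  have -> : log_len n = 1 by case: n n1 => [|[|]].
  by rewrite muln1; lia.
apply: (@leq_trans (n ^ (2 * k))); last first.
  by apply: leq_trans (leq_addr _ _); rewrite leq_exp2l // leq_addl.
case: k {Hf} => [|k]; first by rewrite mul0n muln0 expn0.
rewrite mulnC 2!expnM leq_exp2r // -mulnn /log_len (expnS 2) leq_mul // trunc_logP //.
exact: ltnW.
Qed.

(** * Formulas and their translation from and to circuits *)

Inductive formula (I : Type) :=
  | FVar of I
  | FConst of bool
  | FNot of formula I
  | FAnd of formula I & formula I.

Arguments FConst {I}.

Fixpoint feval I (x : I -> bool) (f : formula I) : bool :=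
  match f with
  | FVar i => x i
  | FConst b => b
  | FNot g => ~~ feval x g
  | FAnd g h => feval x g && feval x h
  end.

Fixpoint fdepth I (f : formula I) : nat :=
  match f with
  | FVar _ | FConst _ => 0
  | FNot g => (fdepth g).+1
  | FAnd g h => (maxn (fdepth g) (fdepth h)).+1
  end.

Fixpoint fsize I (f : formula I) : nat :=
  match f with
  | FVar _ | FConst _ => 1
  | FNot g => (fsize g).+1
  | FAnd g h => (fsize g + fsize h).+1
  end.

Lemma fsize_gt0 I (f : formula I) : 0 < fsize f. Proof. by case: f. Qed.

Lemma fsize_depth I (f : formula I) : fsize f < 2 ^ (fdepth f).+1.
Proof.
elim: f => //= [g IHg|g IHg h IHh]; first by rewrite expnS; lia.
rewrite expnS.
have := @leq_exp2 (fdepth g).+1 (maxn (fdepth g) (fdepth h)).+1 (leq_maxl (fdepth g) (fdepth h)).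
have := @leq_exp2 (fdepth h).+1 (maxn (fdepth g) (fdepth h)).+1 (leq_maxr (fdepth g) (fdepth h)).
lia.
Qed.

Fixpoint fsubst I J (s : I -> formula J) (f : formula I) : formula J :=
  match f with
  | FVar i => s i
  | FConst b => FConst b
  | FNot g => FNot (fsubst s g)
  | FAnd g h => FAnd (fsubst s g) (fsubst s h)
  end.

Lemma feval_subst I J (s : I -> formula J) f x :
  feval x (fsubst s f) = feval (fun i => feval x (s i)) f.
Proof. by elim: f => //= [g ->|g -> h ->]. Qed.

Lemma fdepth_subst I J (s : I -> formula J) f d :
  (forall i, fdepth (s i) <= d) -> fdepth (fsubst s f) <= fdepth f + d.
Proof. by move=> Hs; elim: f => //= g IHg h IHh; lia. Qed.

Definition gate_formula I (fs : seq (formula I)) (g : gate I) : formula I :=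
  let arg := nth (FConst false) fs in
  match g with
  | GInput i => FVar i
  | GConst b => FConst b
  | GNot j => FNot (arg j)
  | GAnd j k => FAnd (arg j) (arg k)
  | GOr j k => FNot (FAnd (FNot (arg j)) (FNot (arg k)))
  end.

Definition unroll I (gs : seq (gate I)) : seq (formula I) :=
  foldl (fun fs g => rcons fs (gate_formula fs g)) [::] gs.

Lemma unroll_values I (x : I -> bool) gs :
  gate_values x gs = [seq feval x f | f <- unroll gs].
Proof.
elim/last_ind: gs => // gs g IH.
rewrite /gate_values /unroll !foldl_rcons map_rcons -/(gate_values x gs) IH.
congr rcons; set fs := foldl _ _ _.
have E j : nth false [seq feval x f | f <- fs] j = feval x (nth (FConst false) fs j).
  have [lt_j|ge_j] := ltnP j (size fs); first by rewrite (nth_map (FConst false)).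
  by rewrite !nth_default ?size_map.
by case: g => //= [j|j k|j k]; rewrite !E // negb_and !negbK.
Qed.

Lemma size_unroll I (gs : seq (gate I)) : size (unroll gs) = size gs.
Proof.
elim/last_ind: gs => // gs g IH.
by rewrite /unroll foldl_rcons !size_rcons -/(unroll gs) IH.
Qed.

Lemma size_gate_depths I (gs : seq (gate I)) : size (gate_depths gs) = size gs.
Proof.
elim/last_ind: gs => // gs g IH.
by rewrite /gate_depths foldl_rcons !size_rcons -/(gate_depths gs) IH.
Qed.

(** The factor 3 is the cost of [GOr], which De Morgan turns into a negation above a conjunction
    above negations. *)
Lemma unroll_depth I (gs : seq (gate I)) j :
  fdepth (nth (FConst false) (unroll gs) j) <= 3 * nth 0 (gate_depths gs) j.
Proof.
elim/last_ind: gs j => [|gs g IH] j; first by rewrite !nth_nil.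
rewrite /unroll /gate_depths !foldl_rcons -/(unroll gs) -/(gate_depths gs).
rewrite !nth_rcons size_unroll size_gate_depths.
case: ifP => // _; case: eqP => // _.
by case: g => //= [j1|j1 j2|j1 j2]; move: (IH j1); try (move: (IH j2)); lia.
Qed.

Definition circuit_formula I (C : circuit I) : formula I :=
  nth (FConst false) (unroll (gates C)) (output C).

Lemma circuit_formula_eval I (C : circuit I) x :
  feval x (circuit_formula C) = circuit_eval C x.
Proof.
rewrite /circuit_eval unroll_values (nth_map (FConst false)) //.
by rewrite size_unroll output_lt_size.
Qed.

Lemma circuit_formula_depth I (C : circuit I) :
  fdepth (circuit_formula C) <= 3 * circuit_depth C.
Proof. exact: unroll_depth. Qed.

(* Postorder listing of the subformulas, the first one getting position [o]. *)
Fixpoint fgates I (f : formula I) (o : nat) : seq (gate I) :=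
  match f with
  | FVar i => [:: GInput i]
  | FConst b => [:: GConst b]
  | FNot g => rcons (fgates g o) (GNot (o + fsize g).-1)
  | FAnd g h =>
      rcons (fgates g o ++ fgates h (o + fsize g))
        (GAnd (o + fsize g).-1 (o + (fsize g + fsize h)).-1)
  end.

Lemma size_fgates I (f : formula I) o : size (fgates f o) = fsize f.
Proof.
by elim: f o => //= [g IH|g IHg h IHh] o; rewrite size_rcons ?size_cat ?IH ?IHg ?IHh.
Qed.

Lemma fgates_well_ordered I (f : formula I) o i : i < fsize f ->
  all (gtn (o + i)) (operands (nth (GConst false) (fgates f o) i)).
Proof.
elim: f o i => [j|b|g IHg|g IHg h IHh] o i; try by case: i.
  rewrite /= nth_rcons size_fgates => le_i; have := fsize_gt0 g.
  case: (ltnP i (fsize g)) => [lt_i|ge_i] _; first exact: IHg.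
  have -> : i = fsize g by lia.
  by rewrite eqxx /= andbT; have := fsize_gt0 g; lia.
rewrite /= nth_rcons size_cat !size_fgates => le_i.
have [gt_g gt_h] := (fsize_gt0 g, fsize_gt0 h).
case: (ltnP i (fsize g + fsize h)) => [lt_i|ge_i].
  rewrite nth_cat size_fgates; case: (ltnP i (fsize g)) => [lt_ig|ge_ig].
    exact: IHg.
   have -> : o + i = o + fsize g + (i - fsize g) by lia.
  by apply: IHh; lia.
have -> : i = fsize g + fsize h by lia.
by rewrite eqxx /= andbT; lia.
Qed.

Section Flatten.

Variables (I V : Type) (v0 : V) (op : seq V -> gate I -> V) (val : formula I -> V).

Hypothesis op_var : forall vs i, op vs (GInput i) = val (FVar i).
Hypothesis op_const : forall vs b, op vs (GConst b) = val (FConst b).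
Hypothesis op_not : forall vs j g, nth v0 vs j = val g ->
  op vs (GNot j) = val (FNot g).
Hypothesis op_and : forall vs j k g h, nth v0 vs j = val g ->
  nth v0 vs k = val h -> op vs (GAnd j k) = val (FAnd g h).

(** One induction serves both values and depths, through different [op] and [val]. The initial list
    [vs] is arbitrary because the gates of the second operand of a conjunction come after those of
    the first. *)
Lemma foldl_fgates f vs : exists2 ws, size ws = (fsize f).-1 &
  foldl (fun vs g => rcons vs (op vs g)) vs (fgates f (size vs)) =
  rcons (vs ++ ws) (val f).
Proof.
elim: f vs => [i|b|g IHg|g IHg h IHh] vs.
- by exists [::]; rewrite //= op_var cats0.
- by exists [::]; rewrite //= op_const cats0.
- have [ws sz E] := IHg vs; exists (rcons ws (val g)).
    by rewrite size_rcons sz prednK ?fsize_gt0.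
  rewrite /= foldl_rcons E -rcons_cat; congr rcons; apply: op_not.
  rewrite nth_rcons size_cat sz.
  have -> : (size vs + fsize g).-1 = size vs + (fsize g).-1.
    by have := fsize_gt0 g; lia.
  by rewrite ltnn eqxx.
have [ws sz E] := IHg vs.
have sz2 : size (rcons (vs ++ ws) (val g)) = size vs + fsize g.
  by rewrite size_rcons size_cat sz; have := fsize_gt0 g; lia.
have [ws' sz' E'] := IHh (rcons (vs ++ ws) (val g)).
exists (rcons ws (val g) ++ rcons ws' (val h)).
  rewrite size_cat !size_rcons sz sz' /=.
  by have := fsize_gt0 g; have := fsize_gt0 h; lia.
rewrite /= foldl_rcons foldl_cat E -sz2 E'.
have -> : vs ++ rcons ws (val g) ++ rcons ws' (val h) =
          rcons (rcons (vs ++ ws) (val g) ++ ws') (val h).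
  by rewrite -!cats1 -!catA.
congr rcons.
have := fsize_gt0 g; have := fsize_gt0 h => gt_h gt_g.
apply: op_and.
  rewrite nth_rcons size_cat sz2 sz' ifT; last by lia.
  rewrite nth_cat sz2 ifT; last by lia.
  rewrite nth_rcons size_cat sz ifN; last by lia.
  by rewrite ifT //; lia.
rewrite nth_rcons size_cat sz2 sz' ifN; last by lia.
by rewrite ifT //; lia.
Qed.

End Flatten.

Lemma flatten_formula_ordered I (f : formula I) : well_ordered (fgates f 0).
Proof. by move=> i; rewrite size_fgates => /(@fgates_well_ordered _ _ 0). Qed.

Lemma flatten_formula_output I (f : formula I) :
  (fsize f).-1 < size (fgates f 0).
Proof. by rewrite size_fgates prednK ?fsize_gt0. Qed.

Definition flatten_formula I (f : formula I) : circuit I :=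
  Circuit (@flatten_formula_ordered I f) (flatten_formula_output f).

Lemma flatten_formula_eval I (f : formula I) x :
  circuit_eval (flatten_formula f) x = feval x f.
Proof.
rewrite /circuit_eval /= /gate_values.
have [||||ws sz /= ->] := @foldl_fgates _ _ false (@gate_value I x) (feval x)
  _ _ _ _ f [::] => //=.
- by move=> vs j g ->.
- by move=> vs j k g h -> ->.
by rewrite nth_rcons sz ltnn eqxx.
Qed.

Lemma flatten_formula_depth I (f : formula I) :
  circuit_depth (flatten_formula f) = fdepth f.
Proof.
rewrite /circuit_depth /= /gate_depths.
have [||||ws sz /= ->] := @foldl_fgates _ _ 0 (@gate_depth I) (@fdepth I)
  _ _ _ _ f [::] => //=.
- by move=> vs j g ->.
- by move=> vs j k g h -> ->.
by rewrite nth_rcons sz ltnn eqxx.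
Qed.

(* The depth alone bounds the size once gates are no longer shared. *)
Lemma NC1_formulaP (A : language bool) :
  NC1 A <-> exists k, forall n, exists2 f : formula 'I_n,
    fdepth f <= k * log_len n & forall x : n.-tuple bool, A x <-> feval (tnth x) f.
Proof.
split=> [[c [k HA]] | [k HA]].
  exists (3 * c) => n; have [C [_ dC evC]] := HA n.
  exists (circuit_formula C) => [|x]; last by rewrite circuit_formula_eval.
  by apply: leq_trans (circuit_formula_depth C) _; rewrite -mulnA leq_mul2l.
have [|l Hl] := @polynomial_bound (fun n => 2 ^ (k.+1 * log_len n)).
  exact: poly_bounded_exp_log poly_bounded_id.
exists k, l => n; have [f df evf] := HA n.
exists (flatten_formula f); split=> [||x].
- rewrite /circuit_size size_fgates; apply: leq_trans (ltnW (fsize_depth f)) _.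
  apply: leq_trans (Hl n); rewrite leq_exp2 // mulSn -add1n.
  by apply: leq_add.
- by rewrite flatten_formula_depth.
by rewrite flatten_formula_eval.
Qed.

(** * Cycles of products of transpositions along a forest *)

Section MergeOrbits.

Variables (T : finType) (s : {perm T}) (x y : T).
Hypothesis xy_apart : x \notin porbit s y.

(** Count orbits: the transposition lowers their number by one, since [x] and [y] are apart. A
    second multiplication restores [s], hence raises the number by one, which forces [x] and [y] to
    share an orbit in between. *)
Lemma porbit_tperm_merge : porbit (tperm x y * s)%g x = porbit (tperm x y * s)%g y.
Proof.
apply/eqP; rewrite eq_porbit_mem.
have ne_xy : x != y by apply: contraNneq xy_apart => ->; exact: porbit_id.
have := porbits_mul_tperm s x y; have := porbits_mul_tperm (tperm x y * s)%g x y.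
rewrite /= mulgA tperm2 mul1g xy_apart ne_xy.
by case: (_ \in _) => //=; lia.
Qed.

(** The points [s z] and [tperm x y z] share an orbit of the product, and so do [tperm x y z] and
    [z] by the merge. Thus orbits of [s] are only united, never split. *)
Lemma porbit_tperm_mono a b : porbit s a = porbit s b ->
  porbit (tperm x y * s)%g a = porbit (tperm x y * s)%g b.
Proof.
set t := (tperm x y * s)%g => eq_ab.
have step z : porbit t (s z) = porbit t z.
  have -> : s z = t (tperm x y z) by rewrite permM tpermK.
  rewrite -[t _]/((t ^+ 1)%g _) porbit_perm.
  by case: tpermP => // ->; rewrite porbit_tperm_merge.
have : a \in porbit s b by rewrite -eq_porbit_mem eq_ab.
case/porbitP=> i ->; rewrite permX.
by elim: i => //= i IH; rewrite step.
Qed.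

End MergeOrbits.

Lemma perm_fixX (T : finType) (s : {perm T}) x n : s x = x -> (s ^+ n)%g x = x.
Proof. by move=> sx; rewrite permX iter_fix. Qed.

Section Forest.

Variables (m : nat) (h : nat -> nat).
Hypothesis h_bounds : forall i, i < m -> i < h i <= m.+1.

Let next a := if a < m then h a else a.

(** Nodes below [m] are internal, [m] is the rejecting sink and [m.+1] the accepting one. Each step
    from an internal node increases it, so [m.+1] steps reach a sink. *)
Definition forest_root (a : nat) : nat := iter m.+1 next a.

Let root := forest_root.

Lemma root_ge a : m <= root a.
Proof.
have H k : m <= iter k next a \/ k <= iter k next a.
  elim: k => [|k [IH|IH]] /=; first by right.
    by left; rewrite /next ltnNge IH.
  rewrite {1 3}/next; case: ltnP => [lt_a|]; last by left.
  by have := h_bounds lt_a; right; lia.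
by have := H m.+1; rewrite -/(forest_root a) -/(root a); lia.
Qed.

Lemma root_step a : root (next a) = root a.
Proof.
rewrite /root /forest_root -iterSr iterS -/(root a).
by rewrite /next ltnNge root_ge.
Qed.

Lemma root_h i : i < m -> root (h i) = root i.
Proof. by move=> lt_i; rewrite -(root_step i) /next lt_i. Qed.

Lemma root_sink a : m <= a -> root a = a.
Proof. by move=> le_a; apply: iter_fix; rewrite /next ltnNge le_a. Qed.

Lemma root_le a : a <= m.+1 -> root a <= m.+1.
Proof.
move=> le_a; have H k : iter k next a <= m.+1.
  elim: k => //= k IH; rewrite {1}/next.
  by case: ltnP => // /h_bounds /andP[].
exact: H.
Qed.

Variables (t K s : nat).
Hypothesis h_tail : forall i, i < K -> h i = m.
Hypothesis le_Km : K <= m.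
Hypothesis lt_mK : m < K.*2.
Hypothesis lt_sm : s < m.
Hypothesis lt_mt : m < t.

Let pt (i : nat) : 'I_t.+1 := inord i.

Definition forest_edge i : {perm 'I_t.+1} := tperm (inord i) (inord (h i)).

Let suf j : {perm 'I_t.+1} := (\prod_(j <= i < m) forest_edge i)%g.

Definition forest_tour : {perm 'I_t.+1} :=
  (tperm (inord m.+1) (inord s) * \prod_(0 <= i < m) forest_edge i)%g.

Lemma val_pt i : i <= m.+1 -> pt i = i :> nat.
Proof. by move=> le_i; rewrite inordK //; lia. Qed.

Lemma pt_inj : {in [pred i | i <= m.+1] &, injective pt}.
Proof. by move=> i j; rewrite !inE => hi hj /(congr1 val) /=; rewrite !val_pt. Qed.

Lemma suf_ind (P : {perm 'I_t.+1} -> Prop) j :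
  P 1%g -> (forall p q, P p -> P q -> P (p * q)%g) ->
  (forall i, j <= i < m -> P (forest_edge i)) -> P (suf j).
Proof. by move=> P1 PM Pe; rewrite /suf big_nat; apply: big_ind. Qed.

Lemma root_tperm i j (a : 'I_t.+1) : i <= m.+1 -> j <= m.+1 -> root i = root j ->
  root (tperm (pt i) (pt j) a) = root a.
Proof. by move=> hi hj e; case: tpermP => // ->; rewrite !val_pt. Qed.

(** Each factor swaps a node with its successor, and these have the same root. Hence no cycle leaves
    its tree; [suf_connect_root] is the converse, that a tree is not broken into several cycles. *)
Lemma root_suf j a : root (suf j a) = root a.
Proof.
move: a; apply: (@suf_ind (fun p => forall a, root (p a) = root a)) => [a|p q Hp Hq a|i].
- by rewrite perm1.
- by rewrite permM Hq Hp.
case/andP=> _ lt_i a; have /andP[_ le_h] := h_bounds lt_i.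
by rewrite root_tperm ?root_h //; lia.
Qed.

Lemma suf_fix i j : i < j -> suf j (pt i) = pt i.
Proof.
move=> lt_ij; apply: (@suf_ind (fun p => p (pt i) = pt i)) => [|p q Hp Hq|k /andP[le_jk lt_k]].
- by rewrite perm1.
- by rewrite permM Hp Hq.
have /andP[lt_kh le_h] := h_bounds lt_k.
by rewrite tpermD //; apply/eqP => /pt_inj; rewrite !inE; lia.
Qed.

(** The edges after [j] only touch nodes above [j], so [suf j.+1] fixes [j], which is therefore
    apart from [h j]. Multiplying by edge [j] merges these two orbits and keeps all connections made
    by the later edges. *)
Lemma suf_connect j i : j <= i < m -> porbit (suf j) (pt i) = porbit (suf j) (pt (h i)).
Proof.
move: {2}(m - j) (erefl (m - j)) => d; elim: d j => [|d IH] j Ed /andP[le_ji lt_i].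
  by lia.
have lt_j : j < m by lia.
have /andP[lt_jh le_h] := h_bounds lt_j.
have apart : pt j \notin porbit (suf j.+1) (pt (h j)).
  rewrite porbit_sym; apply/porbitP=> -[k]; rewrite perm_fixX ?suf_fix //.
  by move/pt_inj; rewrite !inE; lia.
have -> : suf j = (forest_edge j * suf j.+1)%g by rewrite /suf big_ltn.
move: le_ji; rewrite leq_eqVlt => /orP[/eqP <-|lt_ji].
  exact: porbit_tperm_merge.
by apply: porbit_tperm_mono => //; apply: IH; lia.
Qed.

Lemma suf_connect_root a : porbit (suf 0) (pt a) = porbit (suf 0) (pt (root a)).
Proof.
rewrite /root /forest_root; elim: m.+1 => //= k ->.
rewrite {2}/next; case: ltnP => // lt_k; exact: suf_connect.
Qed.

Let nodes : {set 'I_t.+1} := [set pt i | i : 'I_m.+2].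

Lemma pt_nodes i : i <= m.+1 -> pt i \in nodes.
Proof. by move=> le_i; apply/imsetP; exists (inord i) => //; rewrite inordK. Qed.

Lemma perm_on_tperm i j : i <= m.+1 -> j <= m.+1 ->
  perm_on nodes (tperm (pt i) (pt j)).
Proof.
move=> hi hj; apply/subsetP=> a; rewrite inE; apply: contraR => a_out.
by rewrite tpermD //; apply: contraNneq a_out => <-; exact: pt_nodes.
Qed.

Lemma perm_on_tour : perm_on nodes forest_tour.
Proof.
apply: perm_onM; first by apply: perm_on_tperm; lia.
apply: (@suf_ind (perm_on nodes)) => [|p q|i /andP[_ lt_i]].
- exact: perm_on1.
- exact: perm_onM.
have /andP[lt_ih le_h] := h_bounds lt_i.
by apply: perm_on_tperm; lia.
Qed.

Lemma card_nodes : #|nodes| = m.+2.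
Proof.
rewrite card_imset ?card_ord // => i j e; apply/val_inj/pt_inj => //.
  exact: ltn_ord i.
exact: ltn_ord j.
Qed.

Lemma root_porbit j a b : a \in porbit (suf j) b -> root a = root b.
Proof.
case/porbitP=> i ->; rewrite permX; elim: i => //= i <-; exact: root_suf.
Qed.

(** The two trees give two cycles, [s] lies in that of [m], and the extra transposition joins [s] to
    [m.+1]. The result is one cycle through all [m.+2] nodes, while the points outside are fixed. *)
Lemma forest_tour_reject : root s = m -> (forest_tour ^+ m.+2 = 1)%g.
Proof.
move=> root_s.
have apart : pt m.+1 \notin porbit (suf 0) (pt s).
  apply/negP=> /root_porbit; rewrite !val_pt ?root_s ?root_sink //; lia.
have to_m a : a <= m.+1 -> porbit forest_tour (pt a) = porbit forest_tour (pt m).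
  move=> le_a.
  have /(porbit_tperm_mono apart) := suf_connect_root a.
  rewrite -/forest_tour => ->.
  have [->//|->] : root a = m \/ root a = m.+1.
    by have := root_ge a; have := root_le le_a; lia.
  rewrite [LHS]porbit_tperm_merge //.
  by apply: porbit_tperm_mono => //; rewrite suf_connect_root root_s.
have one_orbit : porbit forest_tour (pt m) = nodes.
  apply/eqP; rewrite eqEsubset; apply/andP; split; apply/subsetP=> a.
    case/porbitP=> i ->; rewrite permX; elim: i => [|i IH] /=.
      by apply: pt_nodes.
    by rewrite (perm_closed _ perm_on_tour).
  case/imsetP=> i _ ->; rewrite -eq_porbit_mem to_m //.
  by rewrite -ltnS.
apply/permP=> a; rewrite perm1.
have [a_in|a_out] := boolP (a \in nodes); last first.
  by rewrite perm_fixX // (out_perm perm_on_tour).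
rewrite permX -card_nodes; have : porbit forest_tour a = nodes.
  by case/imsetP: a_in => i _ ->; rewrite to_m // -ltnS.
by move=> <-; rewrite iter_porbit.
Qed.

(* The orbit of the rejecting sink contains more than half of the m + 2 nodes
   but not all of them, so its length does not divide m + 2. *)
Lemma forest_tour_accept : root s = m.+1 -> (forest_tour ^+ m.+2 <> 1)%g.
Proof.
move=> root_s tour1; set r := pt m; set O := porbit forest_tour r.
(* Both points moved by the extra transposition have root [m.+1], whereas the cycle of [r] keeps
   root [m]; on this cycle the tour agrees with [suf 0]. *)
have tour_iter i : iter i forest_tour r = iter i (suf 0) r.
  elim: i => //= i ->; rewrite /forest_tour permM; congr (suf 0 _).
  have : root (iter i (suf 0) r) = m.
    elim: i => [|i IH] /=; last by rewrite root_suf.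
    by rewrite val_pt ?root_sink.
  move=> root_i; apply: tpermD; apply: contra_eqN root_i => /eqP <-.
    by rewrite val_pt // root_sink //; lia.
  by rewrite val_pt ?root_s; lia.
have O_suf a : (a \in O) = (a \in porbit (suf 0) r).
  by apply/porbitP/porbitP=> -[i ->]; exists i; rewrite !permX tour_iter.
have O_gt : K < #|O|.
  have <- : size [seq pt i | i <- rcons (iota 0 K) m] = K.+1.
    by rewrite size_map size_rcons size_iota.
  have /card_uniqP <- : uniq [seq pt i | i <- rcons (iota 0 K) m].
    rewrite map_inj_in_uniq ?rcons_uniq ?iota_uniq ?mem_iota ?andbT; first by lia.
    move=> i j; rewrite !mem_rcons !inE !mem_iota => hi hj.
    by apply: pt_inj; rewrite !inE; lia.
  apply/subset_leq_card/subsetP=> _ /mapP[i i_in ->].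
  rewrite O_suf -eq_porbit_mem; move: i_in.
  rewrite mem_rcons !inE mem_iota => /orP[/eqP -> //|/andP[_ lt_i]].
  by rewrite suf_connect ?h_tail //=; lia.
have O_lt : #|O| < m.+2.
  rewrite -card_nodes; apply: proper_card; apply/properP; split.
    apply/subsetP=> a; case/porbitP=> i ->; rewrite permX; elim: i => [|i IH] /=.
      by apply: pt_nodes.
    by rewrite (perm_closed _ perm_on_tour).
  exists (pt m.+1); first exact: pt_nodes.
  rewrite O_suf; apply/negP=> /root_porbit.
  by rewrite !val_pt ?root_sink //; lia.
(* The tour brings [r] back after [#|O|] steps and, by assumption, after [m.+2] steps, hence also
   after their difference. This lies strictly between 0 and [#|O|], although the first [#|O|]
   iterates are distinct. *)
have fixr : iter (m.+2 - #|O|) forest_tour r = r.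
  rewrite -{1}[r](iter_porbit forest_tour) -/O -iterD subnK; last by lia.
  by rewrite -permX tour1 perm1.
have := uniq_traject_porbit forest_tour r; rewrite -/O => U.
have lt_d : m.+2 - #|O| < #|O| by lia.
have lt_i : m.+2 - #|O| < size (traject forest_tour r #|O|) by rewrite size_traject.
have lt_0 : 0 < size (traject forest_tour r #|O|) by rewrite size_traject; lia.
have := nth_uniq r lt_i lt_0 U; rewrite !nth_traject //; last by lia.
by rewrite fixr eqxx; lia.
Qed.

Lemma forest_tour1 : (forest_tour ^+ m.+2 = 1)%g <-> root s = m.
Proof.
split; last exact: forest_tour_reject.
have : root s = m \/ root s = m.+1.
  have := root_ge s; have := @root_le s; lia.
by case=> // /forest_tour_accept.
Qed.

End Forest.

(** * From logarithmic space to words over the alternating group *)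

Definition literal_value n (x : 'I_n -> bool) (v : option 'I_n) : bool :=
  if v is Some i then x i else false.

Definition literal_formula n (v : option 'I_n) (w : bool -> bool) : formula 'I_n :=
  if v is Some i then
    if w true then if w false then FConst true else FVar i
    else if w false then FNot (FVar i) else FConst false
  else FConst (w false).

Lemma literal_formula_eval n (v : option 'I_n) w x :
  feval x (literal_formula v w) = w (literal_value x v).
Proof.
case: v => [i|] //=.
by case Et: (w true); case Ef: (w false) => //=; case: (x i); rewrite ?Et ?Ef.
Qed.

Lemma literal_formula_depth n (v : option 'I_n) w : fdepth (literal_formula v w) <= 1.
Proof. by case: v => //= i; case: ifP => _; case: ifP. Qed.

Lemma eq_feval I (x y : I -> bool) f : x =1 y -> feval x f = feval y f.
Proof. by move=> e; elim: f => //= [g ->|g -> h ->]. Qed.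

(** Every letter depends on a single literal, so each bit of its encoding is a constant, an input
    bit or a negated one. Substituting these for the variables costs one level of depth. *)
Lemma word_formula n t (C : circuit (word_index t))
    (p : 'I_t -> bool -> {perm 'I_t}) (v : 'I_t -> option 'I_n) :
  decides_Alt_word_problem C ->
  (forall k b, p k b \in ('Alt_('I_t))%g) ->
  exists2 f : formula 'I_n, fdepth f <= 3 * circuit_depth C + 1 &
    forall x, feval x f <-> (\prod_(k < t) p k (literal_value x (v k)) = 1)%g.
Proof.
move=> decC evp.
pose bitf (w : word_index t) :=
  literal_formula (v w.1.1) (fun c => odd (p w.1.1 c w.1.2 %/ 2 ^ w.2)).
exists (fsubst bitf (circuit_formula C)).
  apply: leq_trans (fdepth_subst (d := 1) _ _) _.
    by move=> w; exact: literal_formula_depth.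
  by rewrite leq_add2r circuit_formula_depth.
move=> x; have := decC (fun k => p k (literal_value x (v k))) (fun=> evp _ _).
rewrite -circuit_formula_eval feval_subst.
rewrite (@eq_feval _ _ (fun i => feval x (bitf i))) //.
by move=> [[k i] b]; rewrite /bitf literal_formula_eval.
Qed.

Lemma prodg_periodic (gT : finGroupType) (F : nat -> gT) N p :
  (\prod_(0 <= k < N * p) F (k %% p) = (\prod_(0 <= q < p) F q) ^+ N)%g.
Proof.
elim: N => [|N IH]; first by rewrite mul0n big_geq.
rewrite mulSnr (big_cat_nat (n := N * p)) ?leq_addr //= IH expgSr; congr (_ * _)%g.
rewrite -{1}[N * p]add0n big_addn addKn !big_nat; apply: eq_bigr => i /andP[_ lt_i].
by rewrite addnC modnMDl modn_small.
Qed.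

Lemma prodgM_commute (gT : finGroupType) (F : nat -> gT) u p :
  (forall i, i < p -> commute (F i) u) ->
  (\prod_(0 <= i < p) (F i * u) = (\prod_(0 <= i < p) F i) * u ^+ p)%g.
Proof.
elim: p => [|p IH] cFu; first by rewrite !big_geq ?mulg1.
rewrite !big_nat_recr //= IH; last by move=> i lt_i; apply: cFu; lia.
rewrite expgSr -!mulgA; congr (_ * _)%g; rewrite !mulgA; congr (_ * _)%g.
by apply: commuteX2 _ 1 _; apply: commute_sym; apply: cFu.
Qed.

Lemma tperm_commute (T : finType) (a b c d : T) :
  [/\ a != c, a != d, b != c & b != d] -> commute (tperm a b) (tperm c d).
Proof.
case=> ac ad bc bd.
by rewrite /commute conjgC tpermJ !tpermD // eq_sym.
Qed.

Section ForestWord.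

Variables (n t m K s : nat) (g : nat -> bool -> nat) (v : nat -> option 'I_n).
Hypothesis g_bounds : forall i b, i < m -> i < g i b <= m.+1.
Hypothesis g_tail : forall i b, i < K -> g i b = m.
Hypothesis le_Km : K <= m.
Hypothesis lt_mK : m < K.*2.
Hypothesis lt_sm : s < m.
Hypothesis le_t : m.+2 * m.+2 <= t.

Let edge q b : {perm 'I_t.+1} :=
  if q is i.+1 then tperm (inord i) (inord (g i b))
  else tperm (inord m.+1) (inord s).

Let edge_var q := if q is i.+1 then v i else None.

(* A transposition of two points outside the forest; it makes the letters even
   and cancels out because the word has an even number of letters. *)
Let spare : {perm 'I_t.+1} := tperm (inord m.+2) (inord m.+3).

(** A round of [m.+1] letters spells the tour: position 0 is the extra transposition, position
    [i.+1] the edge out of node [i]. After [m.+2] rounds the word is padded with identities; [le_t]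
    makes room for it. *)
Let letter (k : nat) b : {perm 'I_t.+1} :=
  if k < m.+2 * m.+1 then (edge (k %% m.+1) b * spare)%g else 1%g.

Lemma inord_neq i j : i <= m.+3 -> j <= m.+3 -> i != j ->
  inord i != inord j :> 'I_t.+1.
Proof.
move=> le_i le_j; apply: contraNneq => /(congr1 val) /=.
by rewrite !inordK => [->||]; nia.
Qed.

Lemma letter_even k b : letter k b \in ('Alt_('I_t.+1))%g.
Proof.
rewrite /letter; case: ifP => _; last exact: group1.
rewrite Alt_even odd_permM odd_tperm inord_neq; try lia.
suff : odd_perm (edge (k %% m.+1) b) by move=> ->.
have lt_k : k %% m.+1 < m.+1 by rewrite ltn_pmod.
case: (k %% m.+1) lt_k => [|i] lt_i /=; rewrite odd_tperm inord_neq //; try lia.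
  by have := g_bounds b lt_i; lia.
by have := g_bounds b lt_i; lia.
Qed.

Lemma letter_prod (x : 'I_n -> bool) :
  let h i := g i (literal_value x (v i)) in
  (\prod_(k < t.+1) letter k (literal_value x (edge_var (k %% m.+1))) =
   (forest_tour m h t s) ^+ m.+2)%g.
Proof.
move=> h; pose F q := edge q (literal_value x (edge_var q)).
rewrite -(big_mkord xpredT (fun k => letter k (literal_value x (edge_var (k %% m.+1))))).
rewrite (big_cat_nat (n := m.+2 * m.+1)) //=; last by nia.
rewrite [X in (_ * X)%g]big1_seq ?mulg1; last first.
  by move=> k /andP[_]; rewrite mem_index_iota => /andP[le_k _]; rewrite /letter ltnNge le_k.
have -> : (\prod_(0 <= k < m.+2 * m.+1)
    letter k (literal_value x (edge_var (k %% m.+1))) =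
    \prod_(0 <= k < m.+2 * m.+1) (F (k %% m.+1) * spare))%g.
  rewrite big_nat [RHS]big_nat; apply: eq_bigr => k /andP[_ lt_k].
  by rewrite /letter lt_k.
rewrite (@prodg_periodic _ (fun q => F q * spare)%g).
(* The points of [spare] lie outside the forest, so its copies can be moved past all edges and
   collected in one power. *)
have cF q : q < m.+1 -> commute (F q) spare.
  case: q => [|i] lt_q; apply: tperm_commute.
    by split; apply: inord_neq; lia.
  have := g_bounds (literal_value x (edge_var i.+1)) lt_q.
  by split; apply: inord_neq; lia.
have -> : (\prod_(0 <= q < m.+1) (F q * spare) =
           forest_tour m h t s * spare ^+ m.+1)%g.
  rewrite prodgM_commute //; congr (_ * _)%g.
  by rewrite big_nat_recl.
rewrite expgMn.
  rewrite -expgM; have -> : m.+1 * m.+2 = 2 * (m.+1 * m.+2)./2.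
    by rewrite mul2n halfK oddM /= negbK andNb subn0.
  by rewrite expgM [(spare ^+ 2)%g]tperm2 expg1n mulg1.
apply: commuteX; apply: commute_sym.
rewrite /forest_tour -(@big_nat_recl _ _ _ m 0 F) // big_nat.
by apply: big_ind => [|p q cp cq|i /andP[_ lt_i]]; [exact: commute1 | exact: commuteM |
   exact/commute_sym/cF].
Qed.

Lemma forest_formula (C : circuit (word_index t.+1)) :
  decides_Alt_word_problem C ->
  exists2 f : formula 'I_n, fdepth f <= 3 * circuit_depth C + 1 &
    forall x, feval x f <->
      forest_root m (fun i => g i (literal_value x (v i))) s = m.
Proof.
move=> decC.
have [f df Hf] := @word_formula n _ C (fun k => letter k)
  (fun k => edge_var (k %% m.+1)) decC (fun k b => letter_even k b).
exists f => // x; rewrite Hf letter_prod; apply: (@forest_tour1 _ _ _ t K) => //.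
- by move=> i lt_i; apply: g_bounds.
- by move=> i lt_i; apply: g_tail.
by nia.
Qed.

End ForestWord.

(** * Unrolling a finite automaton in time into a forest *)

Section LayeredForest.

Variables (n : nat) (T : finType) (F : T -> bool -> T) (v : T -> option 'I_n).
Variables (c0 : T) (acc : pred T).

Let N := #|T|.
Let S := N * N.+1.
Let K := S.+1.

(** One layer of [#|T|] states for each time from 0 to [#|T|], preceded by a tail with one node more
    than all layers together, which gives [m < K.*2]. Later times get larger numbers, so successors
    increase. *)
Definition forest_nodes : nat := (#|T| * #|T|.+1).+1 + #|T| * #|T|.+1.

Let m := forest_nodes.

Let dec (i : nat) : T := nth c0 (enum T) i.
Let enc (c : T) : nat := index c (enum T).
Let node (l : nat) (c : T) : nat := K + (l * N + enc c).

Definition layered_next (i : nat) (b : bool) : nat :=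
  if i < K then m
  else let l := (i - K) %/ N in
       let c := dec ((i - K) %% N) in
       if l < N then node l.+1 (F c b) else if acc c then m.+1 else m.

Definition layered_var (i : nat) : option 'I_n :=
  if i < K then None else v (dec ((i - K) %% N)).

Lemma enc_lt c : enc c < N.
Proof. by rewrite /N cardE index_mem mem_enum. Qed.

Lemma encK c : dec (enc c) = c.
Proof. by rewrite /dec nth_index ?mem_enum. Qed.

Lemma card_state_gt0 : 0 < N.
Proof. by apply/card_gt0P; exists c0. Qed.

Lemma node_lt l c : l <= N -> node l c < m.
Proof.
by move=> le_l; have := enc_lt c; rewrite /node /m /forest_nodes -/N -/S -/K /S; nia.
Qed.

Lemma node_div l c : (node l c - K) %/ N = l.
Proof. by rewrite addKn divnMDl ?card_state_gt0 // divn_small ?addn0 ?enc_lt. Qed.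

Lemma node_mod l c : (node l c - K) %% N = enc c.
Proof. by rewrite addKn modnMDl modn_small ?enc_lt. Qed.

Lemma layered_next_node l c b : layered_next (node l c) b =
  if l < N then node l.+1 (F c b) else if acc c then m.+1 else m.
Proof.
by rewrite /layered_next {1}/node ltnNge leq_addr /= node_div node_mod encK.
Qed.

Lemma layered_var_node l c : layered_var (node l c) = v c.
Proof. by rewrite /layered_var {1}/node ltnNge leq_addr /= node_mod encK. Qed.

Lemma layered_next_bounds i b : i < m -> i < layered_next i b <= m.+1.
Proof.
move=> lt_i; rewrite /layered_next; case: (ltnP i K) => [_|le_i]; first by rewrite lt_i leqnSn.
case: (ltnP ((i - K) %/ N) N) => [lt_l|_]; last first.
  by case: ifP => _; rewrite ?lt_i ?leqnSn ?leqnn ?andbT // ltnS ltnW.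
have lt_n := @node_lt ((i - K) %/ N).+1 (F (dec ((i - K) %% N)) b) lt_l.
rewrite (leqW (ltnW lt_n)) andbT /node.
have := divn_eq (i - K) N; have := @ltn_pmod (i - K) N card_state_gt0.
by rewrite mulSn; lia.
Qed.

Lemma layered_root (x : 'I_n -> bool) :
  forest_root m (fun i => layered_next i (literal_value x (layered_var i))) (node 0 c0)
  = if acc (iter N (fun c => F c (literal_value x (v c))) c0) then m.+1 else m.
Proof.
set h := fun i => _; set f := fun c => _.
have h_bounds i : i < m -> i < h i <= m.+1 by exact: layered_next_bounds.
have Hl l : l <= N ->
    forest_root m h (node 0 c0) = forest_root m h (node l (iter l f c0)).
  elim: l => // l IH lt_l; rewrite IH; last exact: ltnW.
  rewrite -(root_h h_bounds (node_lt _ (ltnW lt_l))).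
  by rewrite {2}/h layered_next_node lt_l layered_var_node.
rewrite (Hl N) // -(root_h h_bounds (node_lt _ (leqnn N))).
rewrite {2}/h layered_next_node ltnn; apply: root_sink.
by case: ifP.
Qed.

Lemma automaton_formula t (C : circuit (word_index t.+1)) :
  decides_Alt_word_problem C -> forest_nodes.+2 * forest_nodes.+2 <= t ->
  exists2 f : formula 'I_n, fdepth f <= 3 * circuit_depth C + 2 &
    forall x, feval x f <-> acc (iter #|T| (fun c => F c (literal_value x (v c))) c0).
Proof.
move=> decC le_t.
have Em : m = K + S by [].
have Ks : 0 < S by rewrite /S muln_gt0 card_state_gt0.
have [||||||f df Hf] := @forest_formula n t m K (node 0 c0) layered_next layered_var
   _ _ _ _ _ _ C decC => //.
- by move=> i b; exact: layered_next_bounds.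
- by move=> i b lt_i; rewrite /layered_next lt_i.
- by rewrite Em leq_addr.
- by rewrite Em -addnn ltn_add2l.
- by rewrite node_lt.
(* The product is the identity exactly when the run ends in the rejecting sink, whence the negation
   and its extra level. *)
exists (FNot f) => [|x] /=; first by rewrite addn2 ltnS -addn1.
have := Hf x; rewrite layered_root -/N; case: (feval x f); case: ifP => //= _ [H1 H2];
  split=> //; [have := H1 isT | have := H2 erefl]; lia.
Qed.

End LayeredForest.

(** * Machine configurations for a fixed input length *)

Section Configurations.

Variables (M : machine (option bool)) (n : nat) (a : seq bool) (H : nat).

Let sz := n.+1 + size a.

Definition fconfig : finType :=
  (state M * 'I_sz.+2 * {ffun 'I_H.+1 -> walpha M} * 'I_H.+1)%type.

Definition head_var (p : nat) : option 'I_n := if p is p'.+1 then insub p' else None.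

(** Past the input the symbol depends only on the length and the advice, so it can be read off with
    zeros in place of the input; on the input it is the queried bit [b]. *)
Definition head_symbol (p : nat) (b : bool) : insym (option bool) :=
  if head_var p is Some _ then Defs.Sym (Some b)
  else read_input (with_advice (nseq n false) a) p.

Lemma size_with_advice x : size (with_advice x a) = (size x).+1 + size a.
Proof. by rewrite size_cat /= !size_map addSnnS. Qed.

Lemma head_symbolE (x : n.-tuple bool) p :
  read_input (with_advice x a) p = head_symbol p (literal_value (tnth x) (head_var p)).
Proof.
case: p => [|p] //; rewrite /head_symbol /=; case: insubP => [i lt_p Ei|ge_p] /=.
  rewrite /read_input /= map_cat nth_cat !size_map size_tuple lt_p.
  rewrite (nth_map None) ?size_map ?size_tuple // (nth_map false) ?size_tuple //.
  by rewrite (tnth_nth false) Ei.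
rewrite /read_input /= !map_cat !nth_cat !size_map size_tuple size_nseq.
by rewrite (negPf ge_p).
Qed.

Definition fstep (c : fconfig) (b : bool) : fconfig :=
  let: (q, p, w, h) := c in
  if (q == q_acc M) || (q == q_rej M) then c else
  let: (q', s, mi, mw) := trans q (head_symbol p b) (w h) in
  (q', inord (minn (move_head mi p) sz.+1),
   [ffun r => if r == h then s else w r], inord (move_head mw h)).

Definition fvar (c : fconfig) : option 'I_n := head_var c.1.1.2.

Definition fabs (c : config M) : fconfig :=
  (cstate c, inord (cinhead c), [ffun r : 'I_H.+1 => cwtape c r], inord (cwhead c)).

Lemma fabs_step (x : n.-tuple bool) c : cinhead c <= sz.+1 -> cwhead c <= H ->
  fabs (step (with_advice x a) c) =
  fstep (fabs c) (literal_value (tnth x) (fvar (fabs c))).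
Proof.
move=> le_p le_h; rewrite /fstep /fvar /= inordK // ffunE /step /halted.
case: ifP => // _; rewrite inordK // -head_symbolE.
case: (trans _ _ _) => [[[q s] mi] mw]; rewrite /fabs /=.
rewrite size_with_advice size_tuple; congr (_, _, _, _).
by apply/ffunP=> r; rewrite !ffunE -val_eqE /= inordK.
Qed.

Lemma cinhead_run (x : n.-tuple bool) T :
  cinhead (run M (with_advice x a) T) <= sz.+1.
Proof.
elim: T => // T IH; rewrite /run iterS -/(run _ _ _) /step; case: ifP => // _.
case: (trans _ _ _) => [[[q s] mi] mw] /=.
by rewrite size_with_advice size_tuple geq_minr.
Qed.

Let fnext (x : n.-tuple bool) c := fstep c (literal_value (tnth x) (fvar c)).

Lemma fabs_run (x : n.-tuple bool) T :
  (forall T, cwhead (run M (with_advice x a) T) <= H) ->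
  fabs (run M (with_advice x a) T) = iter T (fnext x) (fabs (init_config M)).
Proof.
move=> le_H; elim: T => // T IH.
by rewrite /run iterS -/(run _ _ _) fabs_step ?cinhead_run // iterS -IH.
Qed.

(** A halting configuration is a fixed point of [fnext], and an orbit visits at most [#|fconfig|]
    configurations. Hence [#|fconfig|] steps suffice, whatever the halting time of the machine. *)
Lemma finite_run_accepts (B : language (option bool)) (x : n.-tuple bool) :
  decides M B ->
  (forall T, cwhead (run M (with_advice x a) T) <= H) ->
  B (with_advice x a) <->
  (iter #|fconfig| (fnext x) (fabs (init_config M))).1.1.1 == q_acc M.
Proof.
move=> decM le_H; have [[T0 haltT0] ->] := decM (with_advice x a).
have stable T : halted (run M (with_advice x a) T) ->
    (iter #|fconfig| (fnext x) (fabs (init_config M))).1.1.1 =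
    cstate (run M (with_advice x a) T).
  move=> haltT; set c0 := fabs _.
  have /iter_findex E : fconnect (fnext x) c0 (iter T (fnext x) c0).
    exact: fconnect_iter.
  have lt_k : findex (fnext x) c0 (iter T (fnext x) c0) < #|fconfig|.
    by apply: leq_trans (findex_max (fconnect_iter _ _ _)) (max_card _).
  rewrite -(subnK (ltnW lt_k)) iterD E -fabs_run //.
  rewrite iter_fix // /fnext /fstep /=.
  by move: haltT; rewrite /halted => ->.
split=> [[T accT] | /eqP acc].
  by rewrite (stable T) ?accT // /halted accT eqxx.
by exists T0; rewrite -stable.
Qed.

End Configurations.

Lemma Lpoly_NC1 (c t0 : nat) :
  (forall t : nat, t0 <= t -> exists C : circuit (word_index t),
     circuit_depth C <= c * trunc_log 2 t /\ decides_Alt_word_problem C) ->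
  forall A : language bool, Lpoly A -> NC1 A.
Proof.
move=> Halt A [B [adv [k [[M [[d bndM] decM]] sz_adv HA]]]].
pose sz n := n.+1 + size (adv n).
pose H n := d * log_len (sz n).
pose FC n := fconfig M n (adv n) (H n).
(* The square is the room required by the word; [t0] brings the degree into the range of the
   hypothesis. *)
pose t n := (forest_nodes (FC n)).+2 * (forest_nodes (FC n)).+2 + t0.
have poly_sz : poly_bounded sz.
  apply: (@poly_bounded_leq _ (fun n => n + 1 + (n ^ k + k))) => [n|].
    by rewrite /sz addn1 leq_add2l sz_adv.
  apply: poly_bounded_add (poly_bounded_polynomial k).
  exact: poly_bounded_add poly_bounded_id (poly_bounded_const 1).
have poly_exp e : poly_bounded (fun n => 2 ^ (e * (H n).+1)).
  apply: (@poly_bounded_leq _ (fun n => 2 ^ (e * d * log_len (sz n)) * 2 ^ e)) => [n|].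
    by rewrite -expnD leq_exp2 // mulnS addnC mulnA.
  apply: poly_bounded_mul (poly_bounded_const _).
  exact: poly_bounded_exp_log.
have poly_FC : poly_bounded (fun n => #|FC n|).
  apply: (@poly_bounded_leq _ (fun n =>
    #|state M| * (sz n + 2) * 2 ^ (#|walpha M| * (H n).+1) * 2 ^ (1 * (H n).+1))) => [n|].
    rewrite /FC !card_prod !card_ord card_ffun card_ord addn2.
    apply: leq_mul; last by rewrite mul1n ltnW // ltn_expl.
    (* The crude bound [a <= 2 ^ a] on the alphabet size turns the number of tapes into a power of 2
       with exponent linear in [H n], hence logarithmic. *)
    apply: leq_mul => //; rewrite expnM leq_exp2r //.
    by rewrite ltnW // ltn_expl.
  apply: poly_bounded_mul (poly_exp 1); apply: poly_bounded_mul (poly_exp _).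
  apply: poly_bounded_mul; first exact: poly_bounded_const.
  exact: poly_bounded_add poly_sz (poly_bounded_const 2).
have poly_t : poly_bounded (fun n => (t n).+1).
  apply: (@poly_bounded_leq _ (fun n => (((#|FC n| * (#|FC n| + 1)) * 2 + 3) ^ 2 + (t0 + 1)))).
    move=> n; rewrite /t /forest_nodes -mulnn; lia.
  apply: poly_bounded_add (poly_bounded_const _); apply: poly_bounded_exp.
  apply: poly_bounded_add (poly_bounded_const _).
  apply: poly_bounded_mul (poly_bounded_const _).
  apply: poly_bounded_mul => //.
  exact: poly_bounded_add (poly_bounded_const _).
have [l Hl] := log_len_poly poly_t.
(* The factor 3 comes from unrolling circuits, [c] from the hypothesis and [l] from the logarithm of
   the polynomial degree; the 2 is for the literals and the final negation. *)
apply/NC1_formulaP; exists (3 * c * l + 2) => n.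
have [|C [dC decC]] := Halt (t n).+1; first by rewrite ltnW // ltnS leq_addl.
pose c0 : FC n := fabs n (adv n) (H n) (init_config M).
have [|f df Hf] := @automaton_formula n (FC n) (@fstep M n (adv n) (H n))
  (@fvar M n (adv n) (H n)) c0 (fun fc => fc.1.1.1 == q_acc M) (t n) C decC.
  by rewrite leq_addr.
exists f => [|x].
  apply: leq_trans df _; rewrite mulnDl; apply: leq_add; last by rewrite leq_pmulr.
  rewrite -!mulnA leq_mul2l /=; apply: leq_trans dC _; rewrite leq_mul2l.
  by rewrite (leq_trans _ (Hl n)) ?orbT.
rewrite HA Hf size_tuple; apply: finite_run_accepts => // T.
by apply: leq_trans (bndM _ _) _; rewrite size_with_advice size_tuple.
Qed.

(** * Two-head automata in logarithmic space *)

Section TwoHead.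

Variables (S Q : finType) (delta : Q -> insym S -> Q * move * bool).
Variables (qi qa qr : Q).

(** The first position is the active head, the only one read and moved; the second is parked. The
    flag [swap] exchanges the roles after the move. *)
Definition two_head_step (y : seq S) (c : Q * nat * nat) : Q * nat * nat :=
  let: (q, p, p') := c in
  if (q == qa) || (q == qr) then c else
  let: (q', mv, swap) := delta q (read_input y p) in
  let p1 := minn (move_head mv p) (size y).+1 in
  if swap then (q', p', p1) else (q', p1, p').

Definition two_head_run (y : seq S) (T : nat) := iter T (two_head_step y) (qi, 0, 0).

Definition two_head_halted (c : Q * nat * nat) := (c.1.1 == qa) || (c.1.1 == qr).

Lemma two_head_step_halted y c : two_head_halted c -> two_head_step y c = c.
Proof. by case: c => [[q p] p']; rewrite /two_head_halted /= => ->. Qed.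

End TwoHead.

(** At rest counter 1 is zero and counter 2 holds the parked position. To swap, the real head walks
    to the left end while counter 1 counts its moves, then walks right while counter 2 is counted
    down; [SwapBack] transfers counter 1 to counter 2. The modes ending in [Back] return the work
    head to cell 0. *)
Variant tmode :=
  Init | Run | ToLeftEnd | Increment | IncrementBack | Decrement | DecrementBack | SwapBack.

Definition tmode_code (m : tmode) : 'I_8 :=
  match m with
  | Init => inord 0 | Run => inord 1 | ToLeftEnd => inord 2 | Increment => inord 3
  | IncrementBack => inord 4 | Decrement => inord 5 | DecrementBack => inord 6
  | SwapBack => inord 7
  end.

Definition tmode_decode (i : 'I_8) : tmode :=
  nth Init [:: Init; Run; ToLeftEnd; Increment; IncrementBack; Decrement;
               DecrementBack; SwapBack] i.

Lemma tmode_codeK : cancel tmode_code tmode_decode.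
Proof. by case; rewrite /tmode_decode inordK. Qed.

HB.instance Definition _ := Finite.copy tmode (can_type tmode_codeK).

Fixpoint binary (s : seq bool) : nat := if s is b :: s' then b + (binary s').*2 else 0.

(* Work tape cells hold one bit of each of two binary counters, least
   significant bit first; cell 0 carries the marker [Some None]. *)
Definition cell : Type := option (option (bool * bool)).

Definition counter1 (s : seq (bool * bool)) : nat := binary (unzip1 s).
Definition counter2 (s : seq (bool * bool)) : nat := binary (unzip2 s).

Definition tape (s : seq (bool * bool)) (p : nat) : cell :=
  nth None (Some None :: [seq Some (Some b) | b <- s]) p.

Lemma tape_at l b r : tape (l ++ b :: r) (size l).+1 = Some (Some b).
Proof. by rewrite /tape /= map_cat nth_cat size_map ltnn subnn. Qed.

Lemma tape_end s : tape s (size s).+1 = None.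
Proof. by rewrite /tape /= nth_default ?size_map. Qed.

Lemma tape_id s h : (fun p => if p == h then tape s h else tape s p) = tape s.
Proof. by apply: functional_extensionality => p; case: eqP => [->|]. Qed.

Lemma tape_set l b b' r :
  (fun p => if p == (size l).+1 then Some (Some b') else tape (l ++ b :: r) p) =
  tape (l ++ b' :: r).
Proof.
apply: functional_extensionality => -[|p] //; rewrite /tape /= eqSS !map_cat !nth_cat.
rewrite size_map /=; case: ltngtP => [//|lt_p|->]; last by rewrite subnn.
by case: (p - size l) (subn_gt0 (size l) p) => //; rewrite lt_p.
Qed.

Lemma tape_extend s b :
  (fun p => if p == (size s).+1 then Some (Some b) else tape s p) = tape (rcons s b).
Proof.
apply: functional_extensionality => -[|p] //; rewrite /tape /= eqSS map_rcons nth_rcons.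
rewrite size_map; case: ltngtP => // lt_p; by rewrite nth_default // size_map ltnW.
Qed.

Fixpoint incr1 (s : seq (bool * bool)) : seq (bool * bool) :=
  match s with
  | [::] => [:: (true, false)]
  | (true, a) :: s' => (false, a) :: incr1 s'
  | (false, a) :: s' => (true, a) :: s'
  end.

Lemma counter1_incr s : counter1 (incr1 s) = (counter1 s).+1.
Proof.
by elim: s => [|[[] a] s IH] //; rewrite /counter1 /= -!/(counter1 _) ?IH; lia.
Qed.

Lemma counter2_incr s : counter2 (incr1 s) = counter2 s.
Proof. by elim: s => [|[[] a] s IH] //; rewrite /counter2 /= -!/(counter2 _) ?IH. Qed.

(** The tape grows only when a carry leaves the top bit, and then the counter is a power of 2. This
    is what keeps the number of cells logarithmic. *)
Lemma size_incr1 s : size (incr1 s) = size s \/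
  size (incr1 s) = (size s).+1 /\ counter1 (incr1 s) = 2 ^ size s.
Proof.
rewrite counter1_incr.
elim: s => [|[[] a] s IH] /=; [by right | | by left].
case: IH => [->|[-> E]]; [by left | right; split=> //].
by rewrite expnS -E /counter1 /= -/(counter1 s); lia.
Qed.

Fixpoint decr2 (s : seq (bool * bool)) : option (seq (bool * bool)) :=
  match s with
  | [::] => None
  | (z, true) :: s' => Some ((z, false) :: s')
  | (z, false) :: s' => omap (cons (z, true)) (decr2 s')
  end.

Lemma decr2_Some s s' : decr2 s = Some s' ->
  [/\ counter2 s = (counter2 s').+1, counter1 s' = counter1 s & size s' = size s].
Proof.
rewrite /counter1 /counter2; elim: s s' => [|[z []] s IH] s' //=; first by case=> <-.
case E: (decr2 s) => [s1|] //= [<-]; have [E2 E1 Es] := IH _ E.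
by rewrite /= E2 E1 Es; split=> //; lia.
Qed.

Lemma decr2_None s : decr2 s = None -> counter2 s = 0.
Proof.
by rewrite /counter2; elim: s => [|[z []] s IH] //=; case: (decr2 s) IH => //= ->.
Qed.

Definition promote (b : bool * bool) : bool * bool := (false, b.1).

Lemma counter1_promote s : counter1 (map promote s) = 0.
Proof. by rewrite /counter1; elim: s => //= b s ->. Qed.

Lemma counter2_promote s : counter2 (map promote s) = counter1 s.
Proof. by rewrite /counter1 /counter2; elim: s => //= b s ->. Qed.

Section Simulation.

Variables (S Q : finType) (delta : Q -> insym S -> Q * move * bool).
Variables (qi qa qr : Q).
Hypothesis qa_neq_qr : qa != qr.

Definition two_head_trans (st : tmode * Q) (sym : insym S) (w : cell) :
    tmode * Q * cell * move * move :=
  let: (m, q) := st in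
  match m with
  | Init => (Run, qi, Some None, MStay, MStay)
  | Run => let: (q', mv, swap) := delta q sym in
           (if swap then ToLeftEnd else Run, q', w, mv, MStay)
  | ToLeftEnd => if sym is LEnd then (Decrement, q, w, MStay, MRight)
                 else (Increment, q, w, MLeft, MRight)
  | Increment =>
      match w with
      | Some (Some (true, a)) => (Increment, q, Some (Some (false, a)), MStay, MRight)
      | Some (Some (false, a)) => (IncrementBack, q, Some (Some (true, a)), MStay, MLeft)
      | _ => (IncrementBack, q, Some (Some (true, false)), MStay, MLeft)
      end
  | IncrementBack =>
      if w is Some None then (ToLeftEnd, q, w, MStay, MStay)
      else (IncrementBack, q, w, MStay, MLeft)
  | Decrement =>
      match w with
      | Some (Some (z, false)) => (Decrement, q, Some (Some (z, true)), MStay, MRight)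
      | Some (Some (z, true)) => (DecrementBack, q, Some (Some (z, false)), MRight, MLeft)
      | _ => (SwapBack, q, w, MStay, MLeft)
      end
  | DecrementBack =>
      if w is Some None then (Decrement, q, w, MStay, MRight)
      else (DecrementBack, q, w, MStay, MLeft)
  | SwapBack =>
      match w with
      | Some None => (Run, q, w, MStay, MStay)
      | Some (Some b) => (SwapBack, q, Some (Some (promote b)), MStay, MLeft)
      | None => (SwapBack, q, w, MStay, MLeft)
      end
  end.

Lemma two_head_acc_neq_rej : (Run, qa) != (Run, qr).
Proof. by rewrite xpair_eqE eqxx. Qed.

Definition two_head_machine : machine S :=
  @Machine S (tmode * Q)%type (option (option (bool * bool))) None (Init, qi)
    (Run, qa) (Run, qr) two_head_acc_neq_rej two_head_trans.

Let M := two_head_machine.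

Definition tconfig m q p s h : config M := @Config S M (m, q) p (tape s) h.

Section FixedInput.

Variables (y : seq S) (W : nat).

Let B := (size y).+1.

Hypothesis log_W : forall k, 2 ^ k <= B -> k < W.

(** Carries the space bound along the whole segment of the run. Counters occupy cells 1 to [W]; cell
    [W.+1] may be visited to detect their end. *)
Definition reaches (c c' : config M) : Prop :=
  exists2 k, iter k (step y) c = c' &
    forall j, j <= k -> cwhead (iter j (step y) c) <= W.+1.

Lemma reaches_refl c : cwhead c <= W.+1 -> reaches c c.
Proof. by move=> Hc; exists 0 => // -[]. Qed.

Lemma reaches_trans c1 c2 c3 : reaches c1 c2 -> reaches c2 c3 -> reaches c1 c3.
Proof.
case=> k1 E1 H1 [k2 E2 H2]; exists (k2 + k1); first by rewrite iterD E1.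
move=> j le_j; have [/H1 //|lt_j] := leqP j k1.
by rewrite -(subnK (ltnW lt_j)) iterD E1 H2 //; lia.
Qed.

Lemma reaches_step c c' : cwhead c <= W.+1 -> reaches (step y c) c' -> reaches c c'.
Proof.
move=> Hc [k E Hk]; exists k.+1; first by rewrite iterSr.
by case=> // j le_j; rewrite iterSr Hk.
Qed.

Lemma step_mode m q p s h : m <> Run -> step y (tconfig m q p s h) =
  let: (q', a, mi, mw) := two_head_trans (m, q) (read_input y p) (tape s h) in
  @Config S M q' (minn (move_head mi p) B)
    (fun r => if r == h then a else tape s r) (move_head mw h).
Proof.
move=> ne_m; rewrite /step /halted /= !xpair_eqE.
by have -> : (m == Run) = false by apply/eqP.
Qed.

Lemma reaches_increment_fwd q p l r : p <= B -> size (l ++ r) <= W ->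
  exists2 h, h <= size (l ++ incr1 r) &
  reaches (tconfig Increment q p (l ++ r) (size l).+1)
          (tconfig IncrementBack q p (l ++ incr1 r) h).
Proof.
move=> le_p; elim: r l => [|[z a] r IH] l le_W.
  exists (size l); first by rewrite size_cat leq_addr.
  rewrite cats0 in le_W *.
  apply: reaches_step => //; rewrite step_mode // tape_end /= tape_extend (minn_idPl _) //.
  by rewrite cats1; apply: reaches_refl; exact: leqW.
have le_l : size l <= W by move: le_W; rewrite size_cat /=; lia.
case: z le_W => le_W.
  have [|h le_h Hh] := IH (rcons l (false, a)); first by move: le_W; rewrite cat_rcons !size_cat.
  exists h; first by move: le_h; rewrite cat_rcons.
  apply: reaches_step => //; rewrite step_mode // tape_at /= tape_set (minn_idPl _) //.
  by move: Hh; rewrite !cat_rcons size_rcons.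
exists (size l); first by rewrite size_cat leq_addr.
apply: reaches_step => //; rewrite step_mode // tape_at /= tape_set (minn_idPl _) //.
by apply: reaches_refl; exact: leqW.
Qed.

Lemma tape_inner s h : 0 < h -> tape s h <> Some None.
Proof.
by case: h => // h _; rewrite /tape /=; elim: s h => [|b s IH] [|h] //=; apply: IH.
Qed.

Lemma reaches_increment_back q p s h : p <= B -> h <= W.+1 ->
  reaches (tconfig IncrementBack q p s h) (tconfig ToLeftEnd q p s 0).
Proof.
move=> le_p; elim: h => [|h IH] le_h; apply: reaches_step => //; rewrite step_mode //.
  by rewrite /= (minn_idPl _) // (tape_id s 0); exact: reaches_refl.
rewrite /two_head_trans; case E: (tape s h.+1) (@tape_inner s h.+1 isT) => [[b|]|] // _.
all: by rewrite /= -E (minn_idPl _) // (tape_id s h.+1); apply: IH; exact: ltnW.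
Qed.

Lemma reaches_decrement_back q p s h : p <= B -> h <= W.+1 ->
  reaches (tconfig DecrementBack q p s h) (tconfig Decrement q p s 1).
Proof.
move=> le_p; elim: h => [|h IH] le_h; apply: reaches_step => //; rewrite step_mode //.
  by rewrite /= (minn_idPl _) // (tape_id s 0); exact: reaches_refl.
rewrite /two_head_trans; case E: (tape s h.+1) (@tape_inner s h.+1 isT) => [[b|]|] // _.
all: by rewrite /= -E (minn_idPl _) // (tape_id s h.+1); apply: IH; exact: ltnW.
Qed.

Lemma reaches_decrement_fwd q p l r r' : p < B -> size (l ++ r) <= W ->
  decr2 r = Some r' ->
  exists2 h, h <= W.+1 &
  reaches (tconfig Decrement q p (l ++ r) (size l).+1)
          (tconfig DecrementBack q p.+1 (l ++ r') h).
Proof.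
move=> lt_p; elim: r r' l => [|[z a] r IH] r' l le_W //=.
have le_l : size l <= W by move: le_W; rewrite size_cat /=; lia.
case: a le_W => le_W.
  case=> <-; exists (size l); first exact: leqW.
  apply: reaches_step => //; rewrite step_mode // tape_at /= tape_set (minn_idPl _) //.
  by apply: reaches_refl; exact: leqW.
case E: (decr2 r) => [r1|] //= [<-].
have [||h le_h Hh] := IH r1 (rcons l (z, true)) => //; first by move: le_W; rewrite cat_rcons !size_cat.
exists h => //; apply: reaches_step => //.
rewrite step_mode // tape_at /= tape_set (minn_idPl _) ?(ltnW lt_p) //.
by move: Hh; rewrite !cat_rcons size_rcons.
Qed.

(** Zero is detected by a borrow running off the end. It leaves ones all over counter 2, which
    [promote] overwrites afterwards. *)
Lemma reaches_underflow_fwd q p l r : p <= B -> size (l ++ r) <= W ->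
  decr2 r = None ->
  reaches (tconfig Decrement q p (l ++ r) (size l).+1)
          (tconfig SwapBack q p (l ++ [seq (b.1, true) | b <- r]) (size (l ++ r))).
Proof.
move=> le_p; elim: r l => [|[z a] r IH] l le_W.
  move=> _; rewrite /= !cats0 in le_W *.
  apply: reaches_step => //; rewrite step_mode // tape_end /= -(tape_end l) (minn_idPl _) //.
  by rewrite tape_id; apply: reaches_refl; exact: leqW.
have le_l : size l <= W by move: le_W; rewrite size_cat /=; lia.
case: a le_W => //= le_W E.
apply: reaches_step => //; rewrite step_mode // tape_at /= tape_set (minn_idPl _) //.
rewrite -!cat_rcons -(size_rcons l (z, true)).
have -> : size (rcons l (z, false) ++ r) = size (rcons l (z, true) ++ r).
  by rewrite !size_cat !size_rcons.
by apply: IH; [rewrite cat_rcons; move: le_W; rewrite !size_cat | case: (decr2 r) E].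
Qed.

Lemma reaches_swap_back q p l r : p <= B -> size l <= W ->
  reaches (tconfig SwapBack q p (l ++ r) (size l))
          (tconfig Run q p (map promote l ++ r) 0).
Proof.
move=> le_p; elim/last_ind: l r => [|l b IH] r.
  move=> _; apply: reaches_step => //; rewrite step_mode // /= (minn_idPl _) //.
  by rewrite (tape_id r 0); exact: reaches_refl.
rewrite size_rcons => le_W; apply: reaches_step; first exact: leqW.
rewrite cat_rcons map_rcons cat_rcons step_mode // tape_at /= tape_set (minn_idPl _) //.
by apply: IH; exact: ltnW.
Qed.

(** Induction on [p]: each round moves the head left and increments counter 1, so [p + counter1 s]
    is invariant. Being at most [B], it prevents the counter from outgrowing [W] cells. *)
Lemma reaches_left_end q p s : size s <= W -> p + counter1 s <= B ->
  exists s', [/\ size s' <= W, counter1 s' = p + counter1 s, counter2 s' = counter2 s &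
    reaches (tconfig ToLeftEnd q p s 0) (tconfig Decrement q 0 s' 1)].
Proof.
elim: p s => [|p IH] s le_s le_B.
  exists s; split=> //; apply: reaches_step => //; rewrite step_mode //=.
  by rewrite (tape_id s 0) min0n; exact: reaches_refl.
have le_s' : size (incr1 s) <= W.
  case: (size_incr1 s) => [-> //|[-> E]]; apply: log_W; rewrite -E counter1_incr.
  by apply: leq_trans le_B; rewrite ltnS leq_addl.
have [||s' [sz c1 c2 R']] := IH (incr1 s) => //; first by rewrite counter1_incr; lia.
exists s'; split=> //; first by rewrite c1 counter1_incr; lia.
  by rewrite c2 counter2_incr.
apply: reaches_step => //; rewrite step_mode //.
have -> : two_head_trans (ToLeftEnd, q) (read_input y p.+1) (tape s 0) =
          (Increment, q, tape s 0, MLeft, MRight).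
  rewrite /= /read_input /=; move: (p) => i.
  by elim: y i => [|b y' IHy] [|i] //=; apply: IHy.
have le_p : p <= B by lia.
rewrite /= (minn_idPl _) // (tape_id s 0).
have [h le_h R1] := @reaches_increment_fwd q p [::] s le_p le_s.
apply: reaches_trans R1 _; apply: reaches_trans R'.
by apply: reaches_increment_back => //; apply: leq_trans le_h _; exact: leqW.
Qed.

(** Induction on counter 2, with [p + counter2 s] invariant; the failing decrement at zero starts
    the transfer of counter 1. *)
Lemma reaches_right q p s : size s <= W -> p + counter2 s <= B ->
  exists s', [/\ size s' <= W, counter1 s' = 0, counter2 s' = counter1 s &
    reaches (tconfig Decrement q p s 1) (tconfig Run q (p + counter2 s) s' 0)].
Proof.
move En: (counter2 s) => n; elim: n p s En => [|n IH] p s En le_s le_B.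
  case E: (decr2 s) => [s1|]; first by case: (decr2_Some E); rewrite En.
  exists (map promote [seq (b.1, true) | b <- s]); split.
  - by rewrite !size_map.
  - exact: counter1_promote.
  - by rewrite counter2_promote /counter1 /unzip1 -map_comp.
  have le_p : p <= B by lia.
  apply: reaches_trans (@reaches_underflow_fwd q p [::] s le_p le_s E) _.
  rewrite /= addn0; have := @reaches_swap_back q p [seq (b.1, true) | b <- s] [::] le_p.
  by rewrite !cats0 size_map; apply.
case E: (decr2 s) => [s1|]; last by have := decr2_None E; rewrite En.
have [E2 E1 Es] := decr2_Some E.
have [|||s' [sz c1 c2 R']] := IH p.+1 s1; try lia.
exists s'; split=> //; first by rewrite c2.
have lt_p : p < B by lia.
have [h le_h R1] := @reaches_decrement_fwd q p [::] s s1 lt_p le_s E.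
apply: reaches_trans R1 _; rewrite -addSnnS; apply: reaches_trans R'.
exact: reaches_decrement_back.
Qed.

Let tstep := two_head_step delta qa qr y.

Lemma tstep_bound q p p' : p <= B -> p' <= B ->
  (tstep (q, p, p')).1.2 <= B /\ (tstep (q, p, p')).2 <= B.
Proof.
move=> le_p le_p'; rewrite /tstep /=; case: ifP => // _.
by case: (delta _ _) => [[q1 mv] []] /=; rewrite ?geq_minr.
Qed.

Lemma reaches_two_head_step q p p' s : p <= B -> p' <= B ->
  size s <= W -> counter1 s = 0 -> counter2 s = p' ->
  exists s', let: (q1, p1, p1') := tstep (q, p, p') in
    [/\ size s' <= W, counter1 s' = 0, counter2 s' = p1' &
    reaches (tconfig Run q p s 0) (tconfig Run q1 p1 s' 0)].
Proof.
move=> le_p le_p' le_s c1 c2; rewrite /tstep /two_head_step.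
case: ifP => [_|halt_q]; first by exists s; split=> //; exact: reaches_refl.
have stepR : step y (tconfig Run q p s 0) =
    let: (q', a, mi, mw) := two_head_trans (Run, q) (read_input y p) (tape s 0) in
    @Config S M q' (minn (move_head mi p) B)
      (fun r => if r == 0 then a else tape s r) (move_head mw 0).
  by rewrite /step /halted /= !xpair_eqE !eqxx halt_q.
move: stepR; rewrite /two_head_trans; case: (delta q _) => [[q1 mv] [] ] /= stepR.
  have le_p1 : minn (move_head mv p) B <= B by exact: geq_minr.
  have [||s1 [sz1 c11 c21 R1]] := @reaches_left_end q1 (minn (move_head mv p) B) s => //.
    by rewrite c1 addn0.
  have [||s2 [sz2 c12 c22 R2]] := @reaches_right q1 0 s1 => //.
    by rewrite c21 c2.
  exists s2; split=> //; first by rewrite c22 c11 c1 addn0.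
  apply: reaches_step => //; rewrite stepR (tape_id s 0).
  by apply: reaches_trans R1 _; rewrite -c2 -c21.
exists s; split=> //; apply: reaches_step => //; rewrite stepR (tape_id s 0).
exact: reaches_refl.
Qed.

Lemma reaches_two_head_run T : exists s, let: (q, p, p') := two_head_run delta qi qa qr y T in
  [/\ p <= B, p' <= B, size s <= W, counter1 s = 0 & counter2 s = p'] /\
  reaches (init_config M) (tconfig Run q p s 0).
Proof.
elim: T => [|T [s]].
  exists [::]; rewrite /=; split=> //; apply: reaches_step => //.
  have -> : step y (init_config M) = tconfig Run qi 0 [::] 0.
    rewrite /step /halted /= !xpair_eqE.
    have -> /= : (Init == Run) = false by apply/eqP.
    congr (@Config S M _ _ _ _).
    by apply: functional_extensionality => -[|p] //; rewrite /tape /= nth_nil.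
  exact: reaches_refl.
rewrite /two_head_run iterS -/(two_head_run _ _ _ _ _ T).
case: (two_head_run _ _ _ _ _ T) => [[q p] p'] [[le_p le_p' sz c1 c2] R1].
have [s'] := @reaches_two_head_step q p p' s le_p le_p' sz c1 c2.
have := @tstep_bound q p p' le_p le_p'; rewrite /tstep.
case: (two_head_step _ _ _ _ _) => [[q1 p1] p1'] [le_p1 le_p1'] [sz' c1' c2' R2].
by exists s'; split=> //; apply: reaches_trans R2.
Qed.

End FixedInput.

Lemma iter_stop (T : Type) (f : T -> T) x i j :
  f (iter i f x) = iter i f x -> i <= j -> iter j f x = iter i f x.
Proof. by move=> fix_i le_ij; rewrite -(subnK le_ij) iterD iter_fix. Qed.

Lemma step_halted y (c : config M) : halted c -> step y c = c.
Proof. by rewrite /step => ->. Qed.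

Lemma two_head_logspace :
  (forall y, exists T, two_head_halted qa qr (two_head_run delta qi qa qr y T)) ->
  logspace (fun y => exists T, (two_head_run delta qi qa qr y T).1.1 = qa).
Proof.
move=> halts; exists M; pose W (y : seq S) := (trunc_log 2 (size y).+1).+1.
have HW y k : 2 ^ k <= (size y).+1 -> k < W y by move=> le_k; rewrite ltnS trunc_log_max.
have final y : exists T k, [/\ two_head_halted qa qr (two_head_run delta qi qa qr y T),
    halted (run M y k),
    cstate (run M y k) = (Run, (two_head_run delta qi qa qr y T).1.1) &
    forall j, cwhead (run M y j) <= (W y).+1].
  have [T haltT] := halts y; have [s] := reaches_two_head_run (HW y) T.
  move: haltT; case E: (two_head_run _ _ _ _ _ T) => [[q p] p'] haltT [_ [k Ek Hk]].
  have haltk : halted (run M y k).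
    by rewrite /run Ek /halted /= !xpair_eqE eqxx.
  exists T, k; split=> //; first by rewrite E.
    by rewrite /run Ek E.
  move=> j; have [/Hk //|/ltnW lt_j] := leqP j k.
  by rewrite /run (iter_stop (step_halted _ haltk)) // Hk.
split.
  (* The head stays within [(W y).+1 <= L + 2], and [L] is at least 1. *)
  exists 3 => y j; have [T [k [_ _ _ /(_ j) H]]] := final y; apply: leq_trans H _.
  rewrite /W; set L := (trunc_log 2 (size y)).+1.
  suff : trunc_log 2 (size y).+1 <= L by rewrite /L; lia.
  rewrite -(@trunc_expnK 2 L) // leq_trunc_log //; exact: trunc_log_ltn.
move=> y; have [T [k [haltT haltk Ek _]]] := final y; split; first by exists k.
split=> [[T' accT'] | [k' acck']].
  have haltT' : two_head_halted qa qr (two_head_run delta qi qa qr y T').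
    by rewrite /two_head_halted accT' eqxx.
  exists k; rewrite Ek.
  suff -> : two_head_run delta qi qa qr y T = two_head_run delta qi qa qr y T'.
    by rewrite accT'.
  rewrite /two_head_run.
  case: (leqP T T') => [|/ltnW] le_T.
    by rewrite (iter_stop (two_head_step_halted _ _ haltT) le_T).
  by rewrite (iter_stop (two_head_step_halted _ _ haltT') le_T).
exists T; have haltk' : halted (run M y k') by rewrite /halted acck' eqxx.
suff E : run M y k = run M y k' by move: Ek; rewrite E acck' => -[].
rewrite /run; case: (leqP k k') => [|/ltnW] le_k.
  by rewrite (iter_stop (step_halted _ haltk) le_k).
by rewrite (iter_stop (step_halted _ haltk') le_k).
Qed.

End Simulation.

(** * Evaluating formulas with advice *)

Notation register := 'I_3 (only parsing).
Definition registers : finType := {ffun register -> bool}.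
Definition instruction : finType := (register * register)%type.

Definition exec_instruction (o : instruction) (b : bool) (r : registers) : registers :=
  [ffun i => if i == o.1 then r o.1 (+) (r o.2 && b) else r i].

Definition reg0 : register := inord 0.
Definition reg1 : register := inord 1.
Definition reg2 : register := inord 2.

Lemma uniq_regs : uniq [:: reg0; reg1; reg2].
Proof. by rewrite /= !inE -!val_eqE /= !inordK. Qed.

Section Compile.

Variable n : nat.

Definition command : Type := (instruction * option 'I_n)%type.

(** Here [None] stands for the constant 1, unlike in [literal_value]: the instruction then adds the
    source register itself. *)
Definition command_bit (x : 'I_n -> bool) (v : option 'I_n) : bool :=
  if v is Some i then x i else true.

Definition exec_commands (x : 'I_n -> bool) (p : seq command) (r : registers) :=
  foldl (fun r c => exec_instruction c.1 (command_bit x c.2) r) r p.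

(** Register [i] is the target, [j] the multiplier and [l] scratch space of arbitrary content. The
    roles are permuted at a conjunction, where each operand is run twice; hence the bound
    [4 ^ fdepth f]. *)
Fixpoint compile (f : formula 'I_n) (i j l : register) : seq command :=
  match f with
  | FVar v => [:: ((i, j), Some v)]
  | FConst b => if b then [:: ((i, j), None)] else [::]
  | FNot g => rcons (compile g i j l) ((i, j), None)
  | FAnd g h =>
      let ph := compile h i l j in let pg := compile g l j i in
      (ph ++ pg) ++ (ph ++ pg)
  end.

(* Over F_2, R_i += R_l h; R_l += R_j g; R_i += R_l h; R_l += R_j g adds R_j g h
   to R_i and restores R_l. *)
Lemma compile_correct x f i j l r : uniq [:: i; j; l] ->
  exec_commands x (compile f i j l) r = exec_instruction (i, j) (feval x f) r.
Proof.
elim: f i j l r => [v|b|g IHg|g IHg h IHh] i j l r U //=.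
- case: b => //=; apply/ffunP=> k; rewrite ffunE /= andbF addbF.
  by case: eqP => [->|].
- rewrite /exec_commands foldl_rcons -/(exec_commands x _ r) (IHg _ _ _ _ U) /=.
  move: U; rewrite /= !inE !negb_or => /andP[/andP[ij il] _].
  have ji : j != i by rewrite eq_sym.
  apply/ffunP=> k; rewrite !ffunE /= eqxx (negPf ji).
  by case: (k == i); case: (r i); case: (r j); case: (feval x g).
move: U; rewrite /= !inE !negb_or andbT => /andP[/andP[ij il] jl].
have ilj : uniq [:: i; l; j] by rewrite /= !inE !negb_or andbT ij il eq_sym jl.
have lji : uniq [:: l; j; i].
  by rewrite /= !inE !negb_or andbT eq_sym jl eq_sym il eq_sym ij.
rewrite /exec_commands !foldl_cat -!/(exec_commands x _ _).
rewrite !(IHg _ _ _ _ lji) !(IHh _ _ _ _ ilj).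
have [ji li lj] : [/\ j != i, l != i & l != j] by split; rewrite eq_sym.
apply/ffunP=> k; rewrite !ffunE /= !eqxx !(negPf ij, negPf il, negPf jl, negPf ji, negPf li, negPf lj).
have [->|ki] := eqVneq k i; last have [->|kl] := eqVneq k l; rewrite ?(negPf il, negPf li) //.
all: by case: (r i); case: (r j); case: (r l); case: (feval x g); case: (feval x h).
Qed.

Lemma size_compile f i j l : size (compile f i j l) <= 4 ^ fdepth f.
Proof.
elim: f i j l => [v|b|g IHg|g IHg h IHh] i j l //=; first by case: b.
  by rewrite size_rcons expnS; have := IHg i j l; lia.
rewrite !size_cat expnS.
have le_g := leq_trans (IHg l j i) (leq_pexp2l (isT : 0 < 4) (leq_maxl (fdepth g) (fdepth h))).
have le_h := leq_trans (IHh i l j) (leq_pexp2l (isT : 0 < 4) (leq_maxr (fdepth g) (fdepth h))).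
lia.
Qed.

End Compile.

(** * The automaton that interprets the advice *)

Notation opcode := 'I_(#|{: instruction}|.+1).

Variant pstate :=
  | Accept | Reject | Seek
  | Fetch of registers & opcode
  | MoveRight of registers
  | Apply of registers & instruction
  | Rewind of registers.

Definition pstate_code (q : pstate) :
    option bool + (registers * opcode) + registers + (registers * instruction) + registers :=
  match q with
  | Accept => inl (inl (inl (inl (Some true))))
  | Reject => inl (inl (inl (inl (Some false))))
  | Seek => inl (inl (inl (inl None)))
  | Fetch r k => inl (inl (inl (inr (r, k))))
  | MoveRight r => inl (inl (inr r))
  | Apply r o => inl (inr (r, o))
  | Rewind r => inr r
  end.

Definition pstate_decode c : pstate :=
  match c with
  | inl (inl (inl (inl (Some true)))) => Accept
  | inl (inl (inl (inl (Some false)))) => Reject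
  | inl (inl (inl (inl None))) => Seek
  | inl (inl (inl (inr (r, k)))) => Fetch r k
  | inl (inl (inr r)) => MoveRight r
  | inl (inr (r, o)) => Apply r o
  | inr r => Rewind r
  end.

Lemma pstate_codeK : cancel pstate_code pstate_decode. Proof. by case. Qed.

HB.instance Definition _ := Finite.copy pstate (can_type pstate_codeK).

(** With 1 in [reg1] and 0 in [reg0], adding [reg1] times the formula to [reg0] leaves the value of
    the formula there. *)
Definition init_registers : registers := [ffun i => i == reg1].

(* The opcode k > 0 stands for the instruction number k - 1. *)
Definition decode (k : opcode) : instruction :=
  nth (reg0, reg0) (enum {: instruction}) k.-1.

(** The left end marker counts as 1, so a head that has not been moved supplies the constant bit of
    a command without variable. *)
Definition symbol_bit (s : insym (option bool)) : bool :=
  match s with LEnd => true | Defs.Sym (Some b) => b | _ => false end.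

(* One head reads the advice once from left to right, the other one is moved in
   the input; an advice bit 0 moves the latter right, and 1^k 0 applies the
   instruction of opcode k to the bit under it and rewinds it. *)
Definition pdelta (q : pstate) (s : insym (option bool)) : pstate * move * bool :=
  match q with
  | Accept | Reject => (q, MStay, false)
  | Seek =>
      match s with
      | Defs.Sym None => (Fetch init_registers ord0, MRight, false)
      | REnd => (Reject, MStay, false)
      | _ => (Seek, MRight, false)
      end
  | Fetch r k =>
      match s with
      | Defs.Sym (Some true) => (Fetch r (inord k.+1), MRight, false)
      | Defs.Sym (Some false) =>
          (if k == ord0 then MoveRight r else Apply r (decode k), MRight, true)
      | _ => (if r reg0 then Accept else Reject, MStay, false)
      end
  | MoveRight r => (Fetch r ord0, MRight, true)
  | Apply r o => (Rewind (exec_instruction o (symbol_bit s) r), MStay, false)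
  | Rewind r =>
      if s is LEnd then (Fetch r ord0, MStay, true) else (Rewind r, MLeft, false)
  end.

Section Evaluate.

Variable y : seq (option bool).

Let B := (size y).+1.

(** Head-free semantics of the remaining advice [s], with [p] the position of the input head. It is
    defined on malformed strings too, since the automaton has to halt on every [y]. *)
Fixpoint evaluate (s : seq (option bool)) (r : registers) (k : opcode) (p : nat) : bool :=
  match s with
  | Some true :: s' => evaluate s' r (inord k.+1) p
  | Some false :: s' =>
      if k == ord0 then evaluate s' r ord0 (minn p.+1 B)
      else evaluate s' (exec_instruction (decode k) (symbol_bit (read_input y p)) r) ord0 0
  | _ => r reg0
  end.

Fixpoint evaluate_advice (s : seq (option bool)) : bool :=
  match s with
  | [::] => false
  | Some _ :: s' => evaluate_advice s'
  | None :: s' => evaluate s' init_registers ord0 0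
  end.

Let pstep := two_head_step pdelta Accept Reject y.

Definition verdict (b : bool) : pstate := if b then Accept else Reject.

Definition ends (c : pstate * nat * nat) (b : bool) : Prop :=
  exists T, (iter T pstep c).1.1 = verdict b.

Lemma ends_step c b : ends (pstep c) b -> ends c b.
Proof. by case=> T E; exists T.+1; rewrite iterSr. Qed.

Lemma pstepE q p p' : q <> Accept -> q <> Reject -> pstep (q, p, p') =
  let: (q', mv, swap) := pdelta q (read_input y p) in
  let p1 := minn (move_head mv p) B in if swap then (q', p', p1) else (q', p1, p').
Proof. by move=> /eqP/negPf qa /eqP/negPf qr; rewrite /pstep /= qa qr. Qed.

Lemma read_input_cat (T : Type) (l : seq T) a r : read_input (l ++ a :: r) (size l).+1 = Defs.Sym a.
Proof. by rewrite /read_input /= map_cat nth_cat size_map ltnn subnn. Qed.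

Lemma read_input_end : read_input y B = REnd.
Proof. by rewrite /read_input /= nth_default ?size_map. Qed.

Lemma ends_rewind r p p' b : p <= B ->
  ends (Fetch r ord0, p', 0) b -> ends (Rewind r, p, p') b.
Proof.
elim: p => [|p IH] le_p E; apply: ends_step; rewrite pstepE //.
have -> : pdelta (Rewind r) (read_input y p.+1) = (Rewind r, MLeft, false).
  rewrite /= /read_input /=; move: (p) => i.
  by elim: y i => [|a y' IHy] [|i] //=; apply: IHy.
by rewrite /= (minn_idPl _); [apply: IH | ]; rewrite ?(ltnW le_p).
Qed.

Lemma ends_fetch l s r k p : y = l ++ s -> p <= B ->
  ends (Fetch r k, (size l).+1, p) (evaluate s r k p).
Proof.
elim: s l r k p => [|[[]|] s IH] l r k p Ey le_p.
- apply: ends_step; rewrite pstepE //.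
  have -> : (size l).+1 = B by rewrite /B Ey cats0.
  by rewrite read_input_end; exists 0.
- have Ey' : y = rcons l (Some true) ++ s by rewrite cat_rcons.
  have le_l : (size l).+2 <= B by rewrite /B Ey size_cat /=; lia.
  apply: ends_step; rewrite pstepE // {1}Ey read_input_cat /= (minn_idPl _) //.
  by rewrite -(size_rcons l (Some true)); apply: IH.
- have Ey' : y = rcons l (Some false) ++ s by rewrite cat_rcons.
  have le_l : (size l).+2 <= B by rewrite /B Ey size_cat /=; lia.
  apply: ends_step; rewrite pstepE // {1}Ey read_input_cat /= (minn_idPl _) //.
  rewrite -(size_rcons l (Some false)) in le_l *.
  case: (k == ord0).
    apply: ends_step; rewrite pstepE //=; apply: IH => //; exact: geq_minr.
  apply: ends_step; rewrite pstepE //= (minn_idPl _) //.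
  by apply: ends_rewind => //; apply: IH.
apply: ends_step; rewrite pstepE // Ey read_input_cat /=.
by exists 0.
Qed.

Lemma ends_seek l s : y = l ++ s -> ends (Seek, (size l).+1, 0) (evaluate_advice s).
Proof.
elim: s l => [|a s IH] l Ey; apply: ends_step; rewrite pstepE //.
  have -> : (size l).+1 = B by rewrite /B Ey cats0.
  by rewrite read_input_end; exists 0.
have Ey' : y = rcons l a ++ s by rewrite cat_rcons.
have le_l : (size l).+2 <= B by rewrite /B Ey size_cat /=; lia.
rewrite {1}Ey read_input_cat; case: a Ey' {Ey} => [a|] Ey' /=.
  by rewrite (minn_idPl _) // -(size_rcons l (Some a)); apply: IH.
by rewrite (minn_idPl _) // -(size_rcons l None); apply: ends_fetch.
Qed.

Lemma ends_run : ends (Seek, 0, 0) (evaluate_advice y).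
Proof.
by apply: ends_step; rewrite pstepE //= (minn_idPl _) //; apply: (@ends_seek [::]).
Qed.

End Evaluate.

Definition advice_result (y : seq (option bool)) : bool := evaluate_advice y y.

Lemma logspace_evaluate_advice : logspace (fun y => advice_result y).
Proof.
have ne_AR : Accept != Reject by apply/eqP.
have [|M [bndM decM]] := @two_head_logspace _ _ pdelta Seek Accept Reject ne_AR.
  move=> y; have [T E] := ends_run y; rewrite -/(advice_result y) in E; exists T; rewrite /two_head_halted E.
  by case: (advice_result y); rewrite eqxx ?orbT.
exists M; split=> // y; have [haltM accM] := decM y; split=> //.
apply: iff_trans accM; have [T E] := ends_run y; rewrite -/(advice_result y) in E; split.
  by move=> acc; exists T; rewrite /two_head_run E acc.
case=> T' acc'; move: E; case: (advice_result y) => // rej.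
have haltT : two_head_halted Accept Reject (two_head_run pdelta Seek Accept Reject y T).
  by rewrite /two_head_halted /two_head_run rej eqxx orbT.
have haltT' : two_head_halted Accept Reject (two_head_run pdelta Seek Accept Reject y T').
  by rewrite /two_head_halted acc' eqxx.
suff E : two_head_run pdelta Seek Accept Reject y T =
         two_head_run pdelta Seek Accept Reject y T'.
  by move: acc'; rewrite -E /two_head_run rej.
rewrite /two_head_run; case: (leqP T T') => [|/ltnW] le_T.
  by rewrite (iter_stop (two_head_step_halted _ _ haltT) le_T).
by rewrite (iter_stop (two_head_step_halted _ _ haltT') le_T).
Qed.

(** * Encoding programs as advice strings *)

Section Advice.

Variable n : nat.

(** Input bit [i] sits at position [i.+1], behind the end marker, hence [i.+1] moves. The opcode is
    at least 1, so its closing [false] cannot be taken for a move. *)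
Definition command_code (c : command n) : seq bool :=
  nseq (if c.2 is Some i then i.+1 else 0) false ++
  nseq (index c.1 (enum {: instruction})).+1 true ++ [:: false].

Definition program_advice (p : seq (command n)) : seq bool :=
  flatten [seq command_code c | c <- p].

Lemma size_command_code c : size (command_code c) <= n + (#|{: instruction}| + 2).
Proof.
rewrite !size_cat !size_nseq -[size [:: _]]/1.
have lt_o : index c.1 (enum {: instruction}) < #|{: instruction}|.
  by rewrite cardE index_mem mem_enum.
by case: c.2 => [i|]; [have := ltn_ord i | ]; lia.
Qed.

Lemma size_program_advice p :
  size (program_advice p) <= size p * (n + (#|{: instruction}| + 2)).
Proof.
rewrite /program_advice; elim: p => //= c p IH.
by rewrite size_cat mulSn leq_add // size_command_code.
Qed.

Lemma evaluate_moves y j s r p : p + j <= (size y).+1 ->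
  evaluate y (nseq j (Some false) ++ s) r ord0 p = evaluate y s r ord0 (p + j).
Proof.
elim: j p => [|j IH] p le_p; first by rewrite addn0.
by rewrite /= (minn_idPl _) ?IH ?addSnnS //; lia.
Qed.

Lemma evaluate_ones y j s r (k : opcode) p : k + j <= #|{: instruction}| ->
  evaluate y (nseq j (Some true) ++ s) r k p = evaluate y s r (inord (k + j)) p.
Proof.
elim: j k => [|j IH] k le_k; first by rewrite addn0 inord_val.
have Ek : @inord #|{: instruction}| k.+1 = k.+1 :> nat by rewrite inordK //; lia.
rewrite /= IH Ek -?addSnnS //; lia.
Qed.

Lemma evaluate_apply y s r (k : opcode) p : k != ord0 ->
  evaluate y (Some false :: s) r k p =
  evaluate y s (exec_instruction (decode k) (symbol_bit (read_input y p)) r) ord0 0.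
Proof. by move=> /negPf k_gt0; rewrite [LHS]/evaluate k_gt0. Qed.

Lemma evaluate_command (x : n.-tuple bool) a c s r :
  let y := with_advice x a in
  evaluate y ([seq Some b | b <- command_code c] ++ s) r ord0 0 =
  evaluate y s (exec_instruction c.1 (command_bit (tnth x) c.2) r) ord0 0.
Proof.
move=> y; rewrite !map_cat !map_nseq -!catA evaluate_moves; last first.
  rewrite size_with_advice size_tuple; case: c.2 => // i.
  by have := ltn_ord i; lia.
have lt_o : index c.1 (enum {: instruction}) < #|{: instruction}|.
  by rewrite cardE index_mem mem_enum.
have Ek : @inord #|{: instruction}| (index c.1 (enum {: instruction})).+1 =
          (index c.1 (enum {: instruction})).+1 :> nat by rewrite inordK.
rewrite evaluate_ones // !add0n.
rewrite evaluate_apply; last by apply/eqP=> /(congr1 (@nat_of_ord _)); rewrite Ek.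
rewrite /decode Ek nth_index ?mem_enum //.
congr (evaluate _ _ (exec_instruction _ _ _) _ _).
case: c.2 => //= i; rewrite /y /with_advice /read_input /= map_cat nth_cat !size_map.
rewrite size_tuple ltn_ord (nth_map None) ?size_map ?size_tuple //.
by rewrite (nth_map false) ?size_tuple //= (tnth_nth false).
Qed.

Lemma evaluate_program (x : n.-tuple bool) a p r :
  evaluate (with_advice x a) [seq Some b | b <- program_advice p] r ord0 0 =
  exec_commands (tnth x) p r reg0.
Proof.
rewrite /program_advice; elim: p r => //= c p IH r.
by rewrite map_cat evaluate_command IH.
Qed.

Lemma evaluate_advice_with (x : n.-tuple bool) p :
  advice_result (with_advice x (program_advice p)) =
  exec_commands (tnth x) p init_registers reg0.
Proof.
rewrite -(evaluate_program x (program_advice p)) /advice_result {2}/with_advice.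
by elim: {2}(tval x).
Qed.

End Advice.

Lemma NC1_Lpoly (A : language bool) : NC1 A -> Lpoly A.
Proof.
move/NC1_formulaP=> [k HA].
pose advised n a := size a <= 2 ^ (2 * k * log_len n) * (n + (#|{: instruction}| + 2)) /\
  forall x : n.-tuple bool, A x <-> advice_result (with_advice x a).
have ex_advice n : exists a, advised n a.
  have [f df Hf] := HA n.
  exists (program_advice (compile f reg0 reg1 reg2)); split.
    apply: leq_trans (size_program_advice _) _; rewrite leq_mul2r; apply/orP; right.
    apply: leq_trans (size_compile _ _ _ _) _.
    by rewrite -[4]/(2 ^ 2) -expnM leq_exp2 // -mulnA leq_mul2l df.
  move=> x; rewrite Hf evaluate_advice_with compile_correct ?uniq_regs //.
  rewrite !ffunE !eqxx /=.
  have -> : (reg0 == reg1) = false by rewrite -val_eqE /= !inordK.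
  by [].
(* For each length a suitable advice is only known to exist; choice makes it a function of [n], with
   no uniformity. *)
pose adv n := sval (constructive_indefinite_description _ (ex_advice n)).
have advP n : advised n (adv n) := svalP (constructive_indefinite_description _ (ex_advice n)).
have [|l Hl] := @polynomial_bound (fun n => size (adv n)).
  apply: poly_bounded_leq (fun n => proj1 (advP n)) _.
  apply: poly_bounded_mul; first exact: poly_bounded_exp_log poly_bounded_id.
  exact: poly_bounded_add poly_bounded_id (poly_bounded_const _).
exists (fun y => advice_result y), adv, l; split=> //; first exact: logspace_evaluate_advice.
by move=> x; exact: (proj2 (advP (size x)) (in_tuple x)).
Qed.

Theorem theorem3p2 :
  (exists c t0 : nat, forall t : nat, t0 <= t ->
     exists C : circuit (word_index t),
       circuit_depth C <= c * trunc_log 2 t /\ decides_Alt_word_problem C) ->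
  forall A : language bool, NC1 A <-> Lpoly A.
Proof.
case=> c [t0 Halt] A; split; first exact: NC1_Lpoly.
exact: (Lpoly_NC1 Halt).
Qed.
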